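(* Let $P(z)=\sum_{m=0}^{N}p_mz^m$ be a polynomial of degree $N\ge1$ with real coefficients $p_m\ge0$, $p_N>0$, $p_0>0$, written as $P(z)=p_N\prod_{j=1}^N(z+\eta_j)$ with $\operatorname{Re}\eta_j\ge0$ for all $j$. Let $X=X_P$ be a random variable with $\Pr\{X=m\}=p_m/P(1)$ and set $W(X)=\frac14\sum_{j=1}^N\frac{\operatorname{Re}(\eta_j)}{1+|\eta_j|^2}$. Suppose $\operatorname{Var}(X)\ge1$. Then $$\sup_{m\in\mathbb{Z}}\left|\Pr(X=m)-\frac{1}{\sqrt{2\pi\operatorname{Var}(X)}}\exp\left(-\frac{(m-E[X])^2}{2\operatorname{Var}(X)}\right)\right|\le\frac{\pi}{4^{2/3}}\frac{\operatorname{Var}(X)^{1/3}}{W(X)}\exp\left(-\frac{4^{1/3}}{\pi^2}\frac{W(X)}{\operatorname{Var}(X)^{2/3}}\right)+\frac{24}{\pi\operatorname{Var}(X)}.$$ *)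

(* Defs.v *)
From HB Require Import structures.
From mathcomp Require Import all_boot all_order all_algebra.
From mathcomp Require Import complex.
From mathcomp Require Import all_classical all_reals all_analysis.

Set Implicit Arguments.
Unset Strict Implicit.
Unset Printing Implicit Defensive.

Import Order.TTheory GRing.Theory Num.Theory.
Import numFieldNormedType.Exports.

Local Open Scope ring_scope.

(* The modulus is the real-valued [normc]; the norm [`|_|] of [R[i]] takes
   its values in [R[i]]. *)
Definition weight (R : realType) (N : nat) (eta : 'I_N -> R[i]) : R :=
  4^-1 * \sum_(j < N)
    complex.Re (eta j) / (1 + ComplexField.Normc.normc (eta j) ^+ 2).

Definition gauss_density (R : realType) (mu v x : R) : R :=
  (Num.sqrt (2 * pi * v))^-1 * expR (- (x - mu) ^+ 2 / (2 * v)).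

(* The quotient by [w] is taken in [\bar R], where [0^-1 = +oo], so that the
   bound is [+oo] when [w = 0] (all the eta_j purely imaginary), instead of
   losing its first term as it would with the convention [0^-1 = 0] of [R]. *)
Definition llt_bound (R : realType) (v w : R) : \bar R :=
  ((pi / 4 `^ (2 / 3))%:E * ((v `^ (1 / 3))%:E / w%:E)
     * (expR (- (4 `^ (1 / 3) / pi ^+ 2 * (w / v `^ (2 / 3)))))%:E
   + (24 / (pi * v))%:E)%E.

(* Main.v *)
(* Fourier inversion on a circle writes [pi * Pr (X = m)] as the integral over
   [0, pi] of the real part of the characteristic function twisted by
   [exp (- i m th)], and [pi] times the Gaussian density as the same integral over
   [0, +oo[ with [exp (- V th^2 / 2)], where [V] is the variance. Split both at a
   cutoff of order [V^(- 1/3)].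
   Above the cutoff, pairing each root with its conjugate (the polynomial is
   real) bounds the modulus of the characteristic function by
   [exp (- W (1 - cos th))], hence by a Gaussian since
   [1 - cos th >= 2 th^2 / pi^2].
   Below it, the same pairing shows that the logarithmic derivative of the centred
   characteristic function is [- V th] up to an error of [4 V th^2]; integrating,
   the two integrands differ by [O(V th^3 exp (- V th^2 / 2))], whose integral is
   [O(1 / V)].
   All these integrals are handled through primitives, by comparing derivatives;
   only the Gaussian transform requires an actual integral. *)

Require Import Defs.
From HB Require Import structures.
From mathcomp Require Import all_boot all_order all_algebra.
From mathcomp Require Import complex.
From mathcomp Require Import all_classical all_reals all_analysis.
From mathcomp Require Import measurable_realfun ring lra.

Import Order.TTheory GRing.Theory Num.Theory.
Import numFieldNormedType.Exports.

Local Open Scope classical_set_scope.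
Local Open Scope ring_scope.

Set Implicit Arguments.
Unset Strict Implicit.
Unset Printing Implicit Defensive.

(** * Derivatives and comparison of increments *)

Section pointwise_derivatives.
Context {R : realType}.
Implicit Types (f g : R -> R) (x a b k : R).

(** Lets the syntax-directed rules below compute the value [a], which is compared with the wanted
    one only afterwards. *)
Lemma is_derive_peq f x a b : is_derive x 1 f a -> a = b -> is_derive x 1 f b.
Proof. by move=> h <-. Qed.

Lemma is_derive_pcst x k : is_derive x 1 (fun=> k) (0 : R).
Proof. exact: is_derive_cst. Qed.

Lemma is_derive_pid x : is_derive x 1 (fun y : R => y) (1 : R).
Proof. exact: is_derive_id. Qed.

Lemma is_derive_pD f g x a b : is_derive x 1 f a -> is_derive x 1 g b ->
  is_derive x 1 (fun y => f y + g y) (a + b).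
Proof. by move=> *; exact: is_deriveD. Qed.

Lemma is_derive_pN f x a : is_derive x 1 f a ->
  is_derive x 1 (fun y => - f y) (- a).
Proof. by move=> *; exact: is_deriveN. Qed.

Lemma is_derive_pM f g x a b : is_derive x 1 f a -> is_derive x 1 g b ->
  is_derive x 1 (fun y => f y * g y) (a * g x + f x * b).
Proof.
move=> fa gb; have := is_deriveM fa gb; rewrite /GRing.scale/= => h.
by apply: (is_derive_eq h); rewrite addrC (mulrC a).
Qed.

Lemma is_derive_pX f n x a : is_derive x 1 f a ->
  is_derive x 1 (fun y => f y ^+ n.+1) (n.+1%:R * f x ^+ n * a).
Proof.
move=> fa; have := @is_deriveX _ _ f n.+1 x 1 a fa; congr is_derive.
by apply/funext => y; rewrite exprfctE.
Qed.

Lemma is_derive_pcomp (phi : R -> R) f x a k : is_derive (f x) 1 phi k ->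
  is_derive x 1 f a -> is_derive x 1 (fun y => phi (f y)) (a * k).
Proof.
move=> hp hf; have h := @is_derive1_comp R phi f x k a hp hf.
by apply: (is_derive_eq h); rewrite /GRing.scale/= mulrC.
Qed.

Lemma is_derive_pexp f x a : is_derive x 1 f a ->
  is_derive x 1 (fun y => expR (f y)) (a * expR (f x)).
Proof. by move=> fa; apply: is_derive_pcomp. Qed.

Lemma is_derive_psin f x a : is_derive x 1 f a ->
  is_derive x 1 (fun y => sin (f y)) (a * cos (f x)).
Proof. by move=> fa; apply: is_derive_pcomp. Qed.

Lemma is_derive_pcos f x a : is_derive x 1 f a ->
  is_derive x 1 (fun y => cos (f y)) (a * - sin (f x)).
Proof. by move=> fa; apply: is_derive_pcomp. Qed.

Lemma is_derive_psum n (f : 'I_n -> R -> R) (a : 'I_n -> R) x :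
  (forall i, is_derive x 1 (f i) (a i)) ->
  is_derive x 1 (fun y => \sum_i f i y) (\sum_i a i).
Proof.
move=> fa; have := is_derive_sum fa; congr is_derive.
by apply/funext => y; rewrite fct_sumE.
Qed.

End pointwise_derivatives.

(* [is_derive] is a class: [notypeclasses] prevents instance resolution from
   solving the subgoals with derivatives in another form. *)
Ltac der1 :=
  first [
    notypeclasses refine (is_derive_pcst _ _)
  | notypeclasses refine (is_derive_pid _)
  | eassumption
  | notypeclasses refine (is_derive_pexp _)
  | notypeclasses refine (is_derive_psin _)
  | notypeclasses refine (is_derive_pcos _)
  | notypeclasses refine (is_derive_pX _ _)
  | notypeclasses refine (is_derive_pN _)
  | notypeclasses refine (is_derive_pD _ _)
  | notypeclasses refine (is_derive_pM _ _)].

Ltac der := notypeclasses refine (is_derive_peq _ _); [repeat der1 | cbv beta; rewrite ?/id].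

Section comparison.
Context {R : realType}.
Implicit Types (f g df dg : R -> R) (a b x : R).

Lemma is_derive_continuous f x a : is_derive x 1 f a -> {for x, continuous f}.
Proof. by move=> [d _]; apply: differentiable_continuous; apply/derivable1_diffP. Qed.

(** The mean value theorem for g - f; it stands in for the monotonicity of the integral. *)
Lemma derive_le f df g dg a b : a <= b ->
  {within `[a, b], continuous f} -> {within `[a, b], continuous g} ->
  (forall x, a < x < b -> is_derive x 1 f (df x)) ->
  (forall x, a < x < b -> is_derive x 1 g (dg x)) ->
  (forall x, a < x < b -> df x <= dg x) ->
  f b - f a <= g b - g a.
Proof.
move=> ab cf cg hf hg hd; have [->|] := eqVneq a b; first by rewrite !subrr.
move=> nab; have {nab}ltab : a < b by rewrite lt_neqAle nab.
have h x : x \in `]a, b[ -> is_derive x 1 (fun y => g y - f y) (dg x - df x).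
  rewrite in_itv/= => xab; apply: is_derive_pD; first exact: hg.
  by apply: is_derive_pN; exact: hf.
have [x|c cab e] := @MVT R (fun x => g x - f x) (fun x => dg x - df x) a b ltab h.
  by apply: continuousB; [exact: cg|exact: cf].
rewrite -subr_ge0; have -> : g b - g a - (f b - f a) = g b - f b - (g a - f a).
  by ring.
rewrite e mulr_ge0 ?subr_ge0//; apply: hd.
by move: cab; rewrite in_itv.
Qed.

Lemma derive_le_seg f df g dg a b : a <= b ->
  (forall x, a <= x <= b -> is_derive x 1 f (df x)) ->
  (forall x, a <= x <= b -> is_derive x 1 g (dg x)) ->
  (forall x, a < x < b -> df x <= dg x) ->
  f b - f a <= g b - g a.
Proof.
move=> ab hf hg; apply: derive_le => //.
- apply: derivable_within_continuous => x; rewrite in_itv/= => xab.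
  by have [] := hf x xab.
- apply: derivable_within_continuous => x; rewrite in_itv/= => xab.
  by have [] := hg x xab.
- by move=> x /andP[ax xb]; apply: hf; rewrite !ltW.
- by move=> x /andP[ax xb]; apply: hg; rewrite !ltW.
Qed.

Lemma derive_norm_le_seg f df g dg a b : a <= b ->
  (forall x, a <= x <= b -> is_derive x 1 f (df x)) ->
  (forall x, a <= x <= b -> is_derive x 1 g (dg x)) ->
  (forall x, a < x < b -> `|df x| <= dg x) ->
  `|f b - f a| <= g b - g a.
Proof.
move=> ab hf hg hd; rewrite ler_norml; apply/andP; split; last first.
  by apply: derive_le_seg hf hg _ => // x /hd; rewrite ler_norml => /andP[].
have := @derive_le_seg (fun x => - g x) (fun x => - dg x) f df a b ab.
have -> : - g b - - g a = - (g b - g a) by ring.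
apply => //; first by move=> x /hg h; der.
by move=> x /hd; rewrite ler_norml => /andP[].
Qed.

(** On [a, b] the factor x / a is at least 1, and x / a * exp (- k x^2) has the explicit primitive -
    exp (- k x^2) / (2 k a). *)
Lemma gauss_tail_le f df k a b : 0 < k -> 0 < a -> a <= b ->
  (forall x, a <= x <= b -> is_derive x 1 f (df x)) ->
  (forall x, a < x < b -> `|df x| <= expR (- (k * x ^+ 2))) ->
  `|f b - f a| <= expR (- (k * a ^+ 2)) / (2 * k * a).
Proof.
move=> k0 a0 ab hf hd; have ka0 : 0 < 2 * k * a by rewrite !mulr_gt0.
have := @derive_norm_le_seg f df (fun x => - (expR (- (k * x ^+ 2)) / (2 * k * a)))
  (fun x => x / a * expR (- (k * x ^+ 2))) a b ab hf.
have -> : - (expR (- (k * b ^+ 2)) / (2 * k * a)) -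
   - (expR (- (k * a ^+ 2)) / (2 * k * a)) =
   expR (- (k * a ^+ 2)) / (2 * k * a) - expR (- (k * b ^+ 2)) / (2 * k * a) by ring.
move=> h; apply: (@le_trans _ _ (expR (- (k * a ^+ 2)) / (2 * k * a) -
   expR (- (k * b ^+ 2)) / (2 * k * a))); last first.
  by rewrite gerBl divr_ge0 ?expR_ge0 ?(ltW ka0).
apply: h => x /andP[ax xb].
  by der; field; rewrite !lt0r_neq0.
have /le_trans := hd x (introT andP (conj ax xb)); apply.
rewrite ler_peMl ?expR_ge0// ler_pdivlMr// mul1r ltW//.
Qed.

End comparison.

(** * Elementary trigonometric inequalities *)

Section trigonometric_bounds.
Context {R : realType}.
Implicit Types x y : R.

(** Starting from cos <= 1, repeated integration from 0 gives this bound and the next two, the first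
    Taylor inequalities. *)
Lemma sin_le_id x : 0 <= x -> sin x <= x.
Proof.
move=> x0.
have := @derive_le_seg R sin cos id (fun=> 1) 0 x x0.
by rewrite sin0 !subr0; apply => y _; exact: cos_le1.
Qed.

Lemma cos_ge_quadratic x : 0 <= x -> 1 - x ^+ 2 / 2 <= cos x.
Proof.
move=> x0.
have := @derive_le_seg R (fun y => - cos y) sin (fun y => y ^+ 2 / 2) id 0 x x0.
rewrite cos0 expr0n/= mul0r.
move=> h; suff : - cos x - - 1 <= x ^+ 2 / 2 - 0 by lra.
simple apply h => y /andP[y0 _].
- by der; ring.
- by der; field.
- by apply: sin_le_id; exact: ltW.
Qed.

Lemma sin_ge_cubic x : 0 <= x -> x - x ^+ 3 / 6 <= sin x.
Proof.
move=> x0.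
have := @derive_le_seg R (fun y => y - y ^+ 3 / 6) (fun y => 1 - y ^+ 2 / 2)
  sin cos 0 x x0.
rewrite sin0 expr0n/= mul0r !subr0; apply => y /andP[y0 _].
- by der; field.
- by apply: cos_ge_quadratic; exact: ltW.
Qed.

Lemma xcos_le_sin x : 0 <= x <= pi -> x * cos x <= sin x.
Proof.
move=> /andP[x0 xpi].
have := @derive_le_seg R (fun y => y * cos y) (fun y => cos y - y * sin y)
  sin cos 0 x x0.
rewrite sin0 mul0r !subr0; apply => y /andP[y0 yx].
- by der; ring.
- by rewrite gerBl mulr_ge0 ?ltW// sin_gt0_pi// y0 (lt_le_trans yx).
Qed.

(** The quotient sin y / y decreases on ]0, pi / 2], its derivative being nonpositive by
    [xcos_le_sin], and equals 2 / pi at the right end. *)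
Lemma jordan_sin x : 0 <= x <= pi / 2 -> 2 * x / pi <= sin x.
Proof.
move=> /andP[]; rewrite le_eqVlt => /orP[/eqP <- _|x0 xpi].
  by rewrite sin0 mulr0 mul0r.
have pi0 := pi_gt0 R.
have := @derive_le_seg R (fun y => sin y / y)
  (fun y => cos y / y - sin y / y ^+ 2) (fun=> 0) (fun=> 0) x (pi / 2) xpi.
rewrite sin_pihalf subrr => h.
have : 1 / (pi / 2) - sin x / x <= 0.
  apply: h => y /andP[xy yp].
  - have y0 : y != 0 by rewrite gt_eqF// (lt_le_trans x0).
    have hV : is_derive y 1 (fun z : R => z^-1) (- y ^- 2).
      have := @is_deriveV R (fun z => z) y 1 1 y0 (is_derive_pid y).
      by move=> h'; apply: (is_derive_eq h'); rewrite /GRing.scale/= mulr1.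
    by der; rewrite mul1r mulrN.
  - have y0 : 0 < y by rewrite (lt_trans x0).
    rewrite subr_le0 ler_pdivlMr ?exprn_gt0// expr2 mulrA divfK ?gt_eqF//.
    rewrite mulrC xcos_le_sin// ltW//= (le_trans (ltW yp))//.
    by lra.
rewrite subr_le0 ler_pdivlMr// => {}h.
by apply: le_trans h; rewrite div1r invf_div mulrAC.
Qed.

(** Half-angle formula 1 - cos x = 2 sin (x / 2)^2, then Jordan's inequality at x / 2. *)
Lemma cos_le_jordan x : 0 <= x <= pi -> 2 * x ^+ 2 / pi ^+ 2 <= 1 - cos x.
Proof.
move=> /andP[x0 xpi]; have pi0 := pi_gt0 R.
have h : 2 * (x / 2) / pi <= sin (x / 2) by apply: jordan_sin; lra.
have -> : cos x = 1 - sin (x / 2) ^+ 2 *+ 2.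
  have {1}-> : x = (x / 2) *+ 2 by rewrite -mulr_natr divfK.
  rewrite cos_mulr2n; have := cos2Dsin2 (x / 2); rewrite !mulr2n; lra.
have : (2 * (x / 2) / pi) ^+ 2 <= sin (x / 2) ^+ 2.
  by rewrite lerXn2r// nnegrE ?divr_ge0 ?mulr_ge0 ?divr_ge0 ?(ltW pi0)// sin_ge0_pi//; lra.
have -> : (2 * (x / 2) / pi) ^+ 2 = x ^+ 2 / pi ^+ 2.
  by rewrite mulrCA divff// mulr1 expr_div_n.
rewrite -mulrA mulr2n; lra.
Qed.

End trigonometric_bounds.

(** * The cosine transform of the Gaussian *)

Section gauss_cosine_transform.
Context {R : realType}.
Implicit Types x y t T V : R.

Let mu := @lebesgue_measure R.

Lemma continuous_integrable_seg (f : R -> R) a b : continuous f ->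
  mu.-integrable `[a, b] (EFin \o f).
Proof.
move=> cf; apply: continuous_compact_integrable; first exact: segment_compact.
exact: continuous_subspaceT.
Qed.

Definition gauss_cos x T := \int[mu]_(t in `[0, T]) (expR (- t ^+ 2) * cos (x * t)).

Lemma gauss_cos_fun_continuous x : continuous (fun t : R => expR (- t ^+ 2) * cos (x * t)).
Proof. by move=> t; apply: is_derive_continuous; repeat der1. Qed.

(* Starting the integral at -1 makes the primitive differentiable at 0. *)
Definition gauss_cos_primitive x T :=
  \int[mu]_(t in `[-1, T]) (expR (- t ^+ 2) * cos (x * t)) -
  \int[mu]_(t in `[-1, 0]) (expR (- t ^+ 2) * cos (x * t)).

Lemma gauss_cos_primitiveE x T : 0 <= T -> gauss_cos_primitive x T = gauss_cos x T.
Proof.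
move=> T0; rewrite /gauss_cos_primitive Rintegral_itvB.
- rewrite Rintegral_itv_obnd_cbnd//.
  apply: (@integrableS _ _ _ mu `[0, T]) => //.
    by apply: subset_itvr; rewrite bnd_simp.
  by apply: continuous_integrable_seg; exact: gauss_cos_fun_continuous.
- by apply: continuous_integrable_seg; exact: gauss_cos_fun_continuous.
- by rewrite bnd_simp lerN10.
- by rewrite bnd_simp.
Qed.

Lemma is_derive_gauss_cos_primitive x T : 0 <= T ->
  is_derive T 1 (gauss_cos_primitive x) (expR (- T ^+ 2) * cos (x * T)).
Proof.
move=> T0; have T1 : T < T + 1 by rewrite ltrDl.
have T2 : -1 < T by lra.
have := @continuous_FTC1_closed R (fun t => expR (- t ^+ 2) * cos (x * t)) (- 1) T
  (T + 1) T1 (continuous_integrable_seg _ _ (@gauss_cos_fun_continuous x)) T2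
  (@gauss_cos_fun_continuous x T).
move=> -[d e]; have h : is_derive T 1
    (fun y => \int[mu]_(t in `[-1, y]) (expR (- t ^+ 2) * cos (x * t)))
    (expR (- T ^+ 2) * cos (x * T)).
  by apply: DeriveDef; [exact: d|rewrite -derive1E].
by rewrite /gauss_cos_primitive; der; rewrite addr0.
Qed.

(* With the weight [exp (x^2 / 4)] the x-derivative of the integrand is the
   t-derivative of an explicit function, so its integral is a boundary term. *)
Lemma is_derive_gauss_cos_param x T : 0 < T ->
  is_derive x 1 (fun y => expR (y ^+ 2 / 4) * gauss_cos y T)
    (expR (x ^+ 2 / 4) * (expR (- T ^+ 2) * sin (x * T) / 2)).
Proof.
move=> T0.
pose u y t := expR (y ^+ 2 / 4) * (expR (- t ^+ 2) * cos (y * t)).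
pose du y t := expR (y ^+ 2 / 4) *
  (expR (- t ^+ 2) * (y / 2 * cos (y * t) - t * sin (y * t))).
have duE y t : is_derive y 1 (u ^~ t) (du y t) by rewrite /u /du; der; field.
have d1E y t : partial1of2 u y t = du y t.
  by rewrite partial1of2E; have [_ ->] := duE y t.
have uE y : expR (y ^+ 2 / 4) * gauss_cos y T = \int[mu]_(t in `[0, T]) u y t.
  rewrite /gauss_cos -RintegralZl//.
  by apply: continuous_integrable_seg; exact: gauss_cos_fun_continuous.
under [X in is_derive _ _ X _]eq_fun do rewrite uE.
(* Dominates the derivative in y uniformly for |y - x| < 1 and t in [0, T], as differentiation under
   the integral requires. *)
pose M := expR ((`|x| + 1) ^+ 2 / 4) * (`|x| + 1 + T).
have Ix : `]x - 1, x + 1[%classic x by rewrite /= in_itv/= gtrBl ltrDl ltr01.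
have intu y : `]x - 1, x + 1[%classic y -> mu.-integrable `[0, T] (EFin \o u y).
  move=> _; apply: continuous_integrable_seg => t.
  by apply: is_derive_continuous; rewrite /u; repeat der1.
have M0 : 0 <= M by rewrite mulr_ge0 ?expR_ge0// !addr_ge0// ltW.
have ub y t : `]x - 1, x + 1[%classic y -> `[0, T]%classic t -> `|partial1of2 u y t| <= M.
  rewrite /= !in_itv/= => /andP[y1 y2] /andP[t0 tT].
  have yx : `|y| <= `|x| + 1.
    have -> : y = x + (y - x) by ring.
    by apply: (le_trans (ler_normD _ _)); rewrite lerD2l ler_norml; apply/andP; lra.
  rewrite d1E /du /M normrM; apply: ler_pM => //.
    rewrite ger0_norm ?expR_ge0// ler_expR ler_pM2r// -real_normK ?num_real//.
    by rewrite lerXn2r// nnegrE ?addr_ge0.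
  rewrite normrM ger0_norm ?expR_ge0// -[leRHS]mul1r.
  apply: ler_pM => //.
    by rewrite -expR0 ler_expR oppr_le0 sqr_ge0.
  apply: (le_trans (ler_normB _ _)); rewrite !normrM (ger0_norm t0).
  have h1 : `|y| * `|2^-1| * `|cos (y * t)| <= `|y|.
    rewrite -[leRHS]mulr1 -mulrA; apply: ler_wpM2l => //.
    rewrite -[leRHS]mulr1; apply: ler_pM => //; last exact: cos_max.
    by rewrite ger0_norm// invf_le1// ler1n.
  have h2 : t * `|sin (y * t)| <= t by rewrite ler_piMr// sin_max.
  by apply: lerD; [exact: le_trans h1 yx|exact: le_trans h2 tT].
have mI : measurable (`[0, T]%classic : set R) by [].
have intM : mu.-integrable `[0, T] (EFin \o (fun=> M)).
  by apply: continuous_integrable_seg; exact: cst_continuous.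
have dM y t : `]x - 1, x + 1[%classic y -> `[0, T]%classic t -> derivable (u ^~ t) y 1.
  by move=> _ _; have [] := duE y t.
apply: DeriveDef; first exact: (@derivable_under_integral _ _ _ mu u `[0, T] mI
  x (x - 1) (x + 1) Ix intu dM (fun=> M) (fun=> M0) intM ub).
rewrite -derive1E (@differentiation_under_integral _ _ _ mu u `[0, T] mI
  x (x - 1) (x + 1) Ix intu dM (fun=> M) (fun=> M0) intM ub).
pose F t := expR (x ^+ 2 / 4) * (expR (- t ^+ 2) * sin (x * t) / 2).
have FE t : is_derive t 1 F (du x t) by rewrite /F /du; der; field.
have -> : \int[mu]_(t in `[0, T]) partial1of2 u x t = \int[mu]_(t in `[0, T]) du x t.
  by apply: eq_Rintegral => t _; rewrite d1E.
have h : (\int[mu]_(t in `[0%R, T]) (du x t)%:E = (F T)%:E - (F 0)%:E)%E.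
  apply: continuous_FTC2 => //.
  - apply: continuous_subspaceT => t.
    by apply: is_derive_continuous; rewrite /du; repeat der1.
  - split.
    + by move=> t _; have [] := FE t.
    + by apply: cvg_at_right_filter; exact: (is_derive_continuous (FE 0)).
    + by apply: cvg_at_left_filter; exact: (is_derive_continuous (FE T)).
  - by move=> t _; rewrite derive1E; have [_ ->] := FE t.
by rewrite /Rintegral h/= {2}/F mulr0 sin0 mulr0 mul0r mulr0 subr0.
Qed.

(** On all of [0, x] the derivative in the parameter is at most exp (x^2 / 4) exp (- T^2) in
    modulus. The dependence of the weighted transform on x thus vanishes as T grows, which reduces
    its limit to the Gauss integral. *)
Lemma gauss_cos_param_le x T : 0 <= x -> 0 < T ->
  `|expR (x ^+ 2 / 4) * gauss_cos x T - gauss_cos 0 T| <=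
  x * expR (x ^+ 2 / 4) * expR (- T ^+ 2).
Proof.
move=> x0 T0; set C := expR (x ^+ 2 / 4) * expR (- T ^+ 2).
have e0 : gauss_cos 0 T = expR (0 ^+ 2 / 4) * gauss_cos 0 T.
  by rewrite expr0n/= mul0r expR0 mul1r.
have bnd y : 0 < y < x ->
    `|expR (y ^+ 2 / 4) * (expR (- T ^+ 2) * sin (y * T) / 2)| <= C.
  move=> /andP[y0 yx]; rewrite /C normrM (ger0_norm (expR_ge0 _)).
  apply: ler_pM; rewrite ?expR_ge0//.
    by rewrite ler_expR ler_pM2r// lerXn2r// ?nnegrE ltW.
  rewrite -mulrA normrM ger0_norm ?expR_ge0// ler_piMr ?expR_ge0//.
  rewrite normrM -[leRHS]mulr1; apply: ler_pM => //; first exact: sin_max.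
  by rewrite ger0_norm// invf_le1// ler1n.
have -> : x * expR (x ^+ 2 / 4) * expR (- T ^+ 2) = C * x - C * 0.
  by rewrite /C; ring.
rewrite ler_norml e0; apply/andP; split.
  rewrite -[X in X <= _]/(- _) opprB.
  have -> : C * 0 - C * x = - C * x - - C * 0 by ring.
  apply: (@derive_le_seg R (fun y => - C * y) (fun=> - C)
   (fun y => expR (y ^+ 2 / 4) * gauss_cos y T)
   (fun y => expR (y ^+ 2 / 4) * (expR (- T ^+ 2) * sin (y * T) / 2))) => //.
  - by move=> y _; der; ring.
  - by move=> y _; exact: is_derive_gauss_cos_param.
  - by move=> y /bnd; rewrite ler_norml => /andP[].
apply: (@derive_le_seg R 
   (fun y => expR (y ^+ 2 / 4) * gauss_cos y T)
   (fun y => expR (y ^+ 2 / 4) * (expR (- T ^+ 2) * sin (y * T) / 2))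
   (fun y => C * y) (fun=> C)) => //.
- by move=> y _; exact: is_derive_gauss_cos_param.
- by move=> y _; der; ring.
- by move=> y /bnd; rewrite ler_norml => /andP[].
Qed.

Lemma gauss_cosN x T : gauss_cos (- x) T = gauss_cos x T.
Proof. by apply: eq_Rintegral => t _; rewrite mulNr cosN. Qed.

Lemma cvg_gauss_cos0 : gauss_cos 0 T @[T --> +oo] --> Num.sqrt (pi : R) / 2.
Proof.
have e T : gauss_cos 0 T = gauss_integral_proof.integral0_gauss T.
  by apply: eq_Rintegral => t _; rewrite mul0r cos0 mulr1.
have -> : Num.sqrt (pi : R) / 2 = Num.sqrt (pi / 4).
  rewrite sqrtrM ?pi_ge0// sqrtrV// (_ : 4 = 2 ^+ 2); last by rewrite expr2 -natrM.
  by rewrite sqrtr_sqr ger0_norm.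
(* The known limit concerns the square of the integral; nonnegativity allows taking the root. *)
under eq_fun do rewrite e -(ger0_norm (gauss_integral_proof.integral0_gauss_ge0 _))
  -sqrtr_sqr.
apply: continuous_cvg; first exact: sqrt_continuous.
exact: gauss_integral_proof.cvg_integral0_gauss_sqr.
Qed.

Lemma cvg_gauss_cos x :
  gauss_cos x T @[T --> +oo] --> expR (- (x ^+ 2 / 4)) * (Num.sqrt pi / 2).
Proof.
wlog x0 : x / 0 <= x.
  move=> h; have [/h//|/ltW x0] := leP 0 x.
  rewrite -sqrrN; under eq_fun do rewrite -gauss_cosN.
  by apply: h; rewrite oppr_ge0.
have c0 : expR (x ^+ 2 / 4) * gauss_cos x T - gauss_cos 0 T @[T --> +oo] --> 0.
  apply/norm_cvg0P; apply: (@squeeze_cvgr _ _ _ _ (cst 0)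
    (fun T => x * expR (x ^+ 2 / 4) * expR (- T ^+ 2))); last 2 first.
  - exact: cvg_cst.
  - rewrite -[X in _ --> X](mulr0 (x * expR (x ^+ 2 / 4))).
    by apply: cvgM; [exact: cvg_cst|exact: cvg_gauss_fun].
  by near=> T; rewrite normr_ge0/= gauss_cos_param_le.
have c1 : expR (x ^+ 2 / 4) * gauss_cos x T @[T --> +oo] --> Num.sqrt pi / 2.
  rewrite -[X in _ --> X]add0r.
  have -> : (fun T => expR (x ^+ 2 / 4) * gauss_cos x T) = (fun T =>
      expR (x ^+ 2 / 4) * gauss_cos x T - gauss_cos 0 T + gauss_cos 0 T).
    by apply/funext => T; rewrite subrK.
  by apply: cvgD => //; exact: cvg_gauss_cos0.
have -> : gauss_cos x = (fun T =>
    expR (- (x ^+ 2 / 4)) * (expR (x ^+ 2 / 4) * gauss_cos x T)).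
  by apply/funext => T; rewrite mulrA -expRD addNr expR0 mul1r.
by apply: cvgM => //; exact: cvg_cst.
Unshelve. all: by end_near. Qed.

(** The substitution t -> k t with k^2 = V / 2 in [cvg_gauss_cos]. The integral is packaged as a
    primitive with a limit, so that the sequel handles only derivatives. *)
Lemma gauss_fourier x V : 0 < V -> exists G : R -> R,
  [/\ G 0 = 0,
      forall T, 0 <= T -> is_derive T 1 G (expR (- (V * T ^+ 2 / 2)) * cos (x * T)) &
      G T @[T --> +oo] --> pi * gauss_density 0 V x].
Proof.
move=> V0; pose k := Num.sqrt (V / 2).
have k0 : 0 < k by rewrite sqrtr_gt0 divr_gt0.
have k2 : k ^+ 2 = V / 2 by rewrite sqr_sqrtr// divr_ge0 ?ltW.
exists (fun T => k^-1 * gauss_cos_primitive (x / k) (k * T)); split.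
- by rewrite mulr0 /gauss_cos_primitive subrr mulr0.
- move=> T T0.
  have h := is_derive_gauss_cos_primitive (x / k) (mulr_ge0 (ltW k0) T0).
  have h2 : is_derive T 1 (fun y => k * y) k by der; ring.
  have h3 := is_derive_pcomp h h2.
  der; rewrite mul0r add0r exprMn k2.
  have -> : x / k * (k * T) = x * T by rewrite mulrA divfK ?gt_eqF.
  by rewrite mulKf ?gt_eqF//; congr (expR _ * _); ring.
- have -> : pi * gauss_density 0 V x =
     k^-1 * (expR (- ((x / k) ^+ 2 / 4)) * (Num.sqrt pi / 2)).
    have -> : - ((x / k) ^+ 2 / 4) = - x ^+ 2 / (2 * V).
      by rewrite expr_div_n k2; field; exact: lt0r_neq0.
    rewrite /gauss_density subr0 mulrA [RHS]mulrCA [RHS]mulrC; congr (_ * _).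
    have p0 := pi_gt0 R; have sp : 0 < Num.sqrt (pi : R) by rewrite sqrtr_gt0.
    have -> : 2 * pi * V = (2 * k) ^+ 2 * pi by rewrite exprMn k2 expr2; field.
    rewrite sqrtrM ?sqr_ge0// sqrtr_sqr gtr0_norm ?mulr_gt0//.
    rewrite -{1}(sqr_sqrtr (ltW p0)).
    move: (Num.sqrt (pi : R)) sp => q q0.
    by field; rewrite !lt0r_neq0.
  apply: cvgM; first exact: cvg_cst.
  have h := @cvg_gauss_cos (x / k).
  apply: (@cvg_trans _ (gauss_cos (x / k) (k * T) @[T --> +oo])).
    apply: near_eq_cvg; near=> T.
    by rewrite gauss_cos_primitiveE// mulr_ge0// ltW.
  apply: (@cvg_comp _ _ _ (fun T => k * T) (gauss_cos (x / k)) _ +oo) => //.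
  apply/cvgryPge => A; near=> T.
  by rewrite -ler_pdivrMl//; near: T; exact: nbhs_pinfty_ge.
Unshelve. all: by end_near. Qed.

End gauss_cosine_transform.

(** * Quadratic factors *)

Section quadratic_factor.
Context {R : realType}.
Implicit Types a e c s th : R.

(* The quadratic [q z = z^2 + 2 a z + e] collects a root [- eta] and its conjugate
   ([a = Re eta], [e = |eta|^2]). [q / q 1] is the generating function of a random
   variable on {0, 1, 2} with variance [qvar a e]. *)
Definition qvar a e : R := (2 * a * (1 + e) + 4 * e) / (1 + 2 * a + e) ^+ 2.

(* [|q (exp (i th))|^2] as a function of [c = cos th]. *)
Definition qmod a e c : R :=
  (1 + 2 * a + e) ^+ 2 - 4 * a * (1 + e) * (1 - c) - 4 * e * (1 - c ^+ 2).

(** Drop the last term of [qmod], then use 2 a <= 1 + e, which gives (1 + 2 a + e)^2 <= 4 (1 + e)^2.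
    This is the decay contributed by one conjugate pair. *)
Lemma qmod_le a e c : 0 <= a -> a ^+ 2 <= e -> -1 <= c <= 1 ->
  qmod a e c <= (1 + 2 * a + e) ^+ 2 * (1 - a / (1 + e) * (1 - c)).
Proof.
move=> a0 ae /andP[c1 c2].
have e0 : 0 <= e by apply: le_trans ae; exact: sqr_ge0.
have t0 : 0 < 1 + e by lra.
have ta : 2 * a <= 1 + e by have := sqr_ge0 (a - 1); rewrite sqrrB; lra.
rewrite mulrBr mulr1 /qmod.
have h1 : 0 <= 4 * e * (1 - c ^+ 2).
  have -> : 1 - c ^+ 2 = (1 - c) * (1 + c) by ring.
  by rewrite !mulr_ge0//; lra.
suff h2 : (1 + 2 * a + e) ^+ 2 * (a / (1 + e) * (1 - c)) <= 4 * a * (1 + e) * (1 - c).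
  by lra.
have -> : (1 + 2 * a + e) ^+ 2 * (a / (1 + e) * (1 - c)) =
   (1 + 2 * a + e) ^+ 2 / (1 + e) * (a * (1 - c)) by ring.
have -> : 4 * a * (1 + e) * (1 - c) = 4 * (1 + e) * (a * (1 - c)) by ring.
apply: ler_wpM2r; first by rewrite mulr_ge0//; lra.
rewrite ler_pdivrMr//.
have -> : 4 * (1 + e) * (1 + e) = (2 * (1 + e)) ^+ 2 by ring.
by rewrite ler_sqr ?nnegrE; lra.
Qed.

(** Both sides agree at c = 1, so the difference has the factor 1 - c, with a nonnegative cofactor.
    This controls the denominators of the logarithmic derivative. *)
Lemma qmod_ge a e c : 0 <= a -> a ^+ 2 <= e -> 0 <= c <= 1 ->
  c ^+ 2 * (1 + 2 * a + e) ^+ 2 <= qmod a e c.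
Proof.
move=> a0 ae /andP[c1 c2]; rewrite -subr_ge0 /qmod.
have e0 : 0 <= e by apply: le_trans ae; exact: sqr_ge0.
have -> : (1 + 2 * a + e) ^+ 2 - 4 * a * (1 + e) * (1 - c) - 4 * e * (1 - c ^+ 2)
   - c ^+ 2 * (1 + 2 * a + e) ^+ 2 = 
   (1 - c) * ((4 * a ^+ 2 + (1 - e) ^+ 2) * (1 + c) + 4 * a * (1 + e) * c) by ring.
apply: mulr_ge0; first lra.
apply: addr_ge0; last by rewrite !mulr_ge0//; lra.
apply: mulr_ge0; last lra.
by apply: addr_ge0; rewrite ?sqr_ge0//; apply: mulr_ge0; rewrite ?sqr_ge0.
Qed.

Lemma qmod_leD a e c : 0 <= a -> a ^+ 2 <= e -> 0 <= c <= 1 ->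
  qmod a e c <= (1 + 2 * a + e) ^+ 2.
Proof.
move=> a0 ae /andP[c1 c2]; rewrite /qmod.
have e0 : 0 <= e by apply: le_trans ae; exact: sqr_ge0.
have h1 : 0 <= 4 * e * (1 - c ^+ 2).
  have -> : 1 - c ^+ 2 = (1 - c) * (1 + c) by ring.
  by rewrite !mulr_ge0//; lra.
have h2 : 0 <= 4 * a * (1 + e) * (1 - c) by rewrite !mulr_ge0//; lra.
lra.
Qed.

Lemma qvar_ge0 a e : 0 <= a -> 0 <= e -> 0 <= qvar a e.
Proof. by move=> a0 e0; rewrite divr_ge0 ?sqr_ge0 ?addr_ge0 ?mulr_ge0 ?addr_ge0. Qed.

(** The fraction is the imaginary part of z q'(z) / q(z) at z = c + i s. The bounds c^2 q(1)^2 <=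
    [qmod] <= q(1)^2 enclose it between [qvar] times s c and [qvar] times th / c^2. *)
Lemma q_logderiv_re a e c s th : 0 <= a -> a ^+ 2 <= e ->
  0 <= th <= 9 / 10 -> 3 / 5 <= c <= 1 -> 0 <= s <= th -> c ^+ 2 + s ^+ 2 = 1 ->
  th - th ^+ 2 <= s * c ->
  `|s * (2 * a * (1 + e) + 4 * e * c) / qmod a e c - qvar a e * th| <=
    5 / 2 * (qvar a e * th ^+ 2).
Proof.
move=> a0 ae /andP[th0 th1] /andP[c0 c1] /andP[s0 sth] cs sc.
have e0 : 0 <= e by apply: le_trans ae; exact: sqr_ge0.
have D0 : 0 < 1 + 2 * a + e by lra.
have c01 : 0 <= c <= 1 by apply/andP; split; lra.
have c20 : 0 < c ^+ 2 by rewrite exprn_gt0//; lra.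
have M1 := qmod_ge a0 ae c01; have M2 := qmod_leD a0 ae c01.
have D2 : 0 < (1 + 2 * a + e) ^+ 2 by rewrite exprn_gt0.
have M0 : 0 < qmod a e c by apply: lt_le_trans M1; rewrite mulr_gt0.
have v0 := qvar_ge0 a0 e0.
set m := 2 * a * (1 + e) + 4 * e * c.
have m1 : m <= 2 * a * (1 + e) + 4 * e.
  by rewrite lerD2l ler_piMr//; lra.
have m2 : c * (2 * a * (1 + e) + 4 * e) <= m.
  rewrite mulrDr /m (mulrC c (4 * e)) lerD2r ler_piMl// !mulr_ge0//; lra.
have m0 : 0 <= m by apply: le_trans m2; rewrite !(mulr_ge0, addr_ge0)//; lra.
have lo : qvar a e * (s * c) <= s * m / qmod a e c.
  apply: (@le_trans _ _ (s * m / (1 + 2 * a + e) ^+ 2)).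
    have -> : qvar a e * (s * c) =
        s * (c * (2 * a * (1 + e) + 4 * e)) / (1 + 2 * a + e) ^+ 2.
      by rewrite /qvar; ring.
    by apply: ler_wpM2r; [rewrite invr_ge0 ltW|exact: ler_wpM2l].
  by apply: ler_wpM2l; rewrite ?mulr_ge0// lef_pV2.
have hi : s * m / qmod a e c <= qvar a e * (th / c ^+ 2).
  apply: (@le_trans _ _ (s * m / (c ^+ 2 * (1 + 2 * a + e) ^+ 2))).
    by apply: ler_wpM2l; rewrite ?mulr_ge0// lef_pV2// posrE mulr_gt0.
  have -> : qvar a e * (th / c ^+ 2) = th * (2 * a * (1 + e) + 4 * e) /
     (c ^+ 2 * (1 + 2 * a + e) ^+ 2).
    by rewrite /qvar; field; rewrite !lt0r_neq0//; lra.
  apply: ler_wpM2r; first by rewrite invr_ge0 ltW// mulr_gt0.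
  exact: ler_pM.
(* Since 1 = c^2 + s^2 and s <= th, the excess over th is at most th^3 / c^2; 5 / 2 is the bound 9 /
   10 on th over the bound 9 / 25 on c^2. *)
have b : th / c ^+ 2 <= th + 5 / 2 * th ^+ 2.
  rewrite ler_pdivrMr// mulrDl.
  have s2 : s ^+ 2 <= th ^+ 2 by rewrite lerXn2r// nnegrE.
  have c9 : 9 / 25 <= c ^+ 2.
    have -> : 9 / 25 = (3 / 5 : R) ^+ 2 by field.
    by rewrite ler_sqr// nnegrE; lra.
  have h1 : th * th ^+ 2 <= 9 / 10 * th ^+ 2 by rewrite ler_wpM2r// sqr_ge0.
  have h2 : 9 / 10 * th ^+ 2 <= 5 / 2 * th ^+ 2 * c ^+ 2.
    by rewrite [leRHS]mulrAC; apply: ler_wpM2r; [exact: sqr_ge0|lra].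
  have h3 : th * (s ^+ 2) <= th * th ^+ 2 by rewrite ler_wpM2l.
  have h4 : th = th * c ^+ 2 + th * s ^+ 2 by rewrite -mulrDr cs mulr1.
  by rewrite {1}h4 lerD2l; apply: le_trans h3 _; exact: le_trans h1 h2.
have hi2 := ler_wpM2l v0 b; have lo2 := ler_wpM2l v0 sc.
have p0 : 0 <= qvar a e * th ^+ 2 by rewrite mulr_ge0// sqr_ge0.
rewrite mulrDr in hi2; rewrite mulrBr in lo2.
by rewrite ler_norml; apply/andP; split; lra.
Qed.

(** This is the real part of z q'(z) / q(z) minus its value at z = 1. It factors through (1 - e) /
    (1 + 2 a + e), of modulus at most 1, and 1 - c, of second order in th. *)
Lemma q_logderiv_im a e c th : 0 <= a -> a ^+ 2 <= e ->
  3 / 5 <= c <= 1 -> 1 - c <= th ^+ 2 / 2 ->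
  `|(1 - e) * (1 + e + 2 * a * c) / qmod a e c - (1 - e) / (1 + 2 * a + e)| <=
    14 / 5 * (qvar a e * th ^+ 2).
Proof.
move=> a0 ae /andP[c0 c1] cth.
have e0 : 0 <= e by apply: le_trans ae; exact: sqr_ge0.
have D0 : 0 < 1 + 2 * a + e by lra.
have c01 : 0 <= c <= 1 by apply/andP; split; lra.
have c20 : 0 < c ^+ 2 by rewrite exprn_gt0//; lra.
have M1 := qmod_ge a0 ae c01.
have D2 : 0 < (1 + 2 * a + e) ^+ 2 by rewrite exprn_gt0.
have M0 : 0 < qmod a e c by apply: lt_le_trans M1; rewrite mulr_gt0.
have v0 := qvar_ge0 a0 e0.
have ta : 2 * a <= 1 + e by have := sqr_ge0 (a - 1); rewrite sqrrB; lra.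
set w := 2 * a * (1 + e - 2 * a) + 4 * e * (1 + c).
have w0 : 0 <= w.
  by apply: addr_ge0; apply: mulr_ge0; rewrite ?mulr_ge0//; lra.
have w1 : w <= 2 * (2 * a * (1 + e) + 4 * e).
  have h1 : 2 * a * (1 + e - 2 * a) <= 2 * a * (1 + e) by rewrite ler_wpM2l ?mulr_ge0//; lra.
  have h2 : 4 * e * (1 + c) <= 4 * e * 2 by rewrite ler_wpM2l ?mulr_ge0//; lra.
  have h3 : 0 <= 2 * a * (1 + e) by rewrite !mulr_ge0//; lra.
  by rewrite /w; lra.
have -> : (1 - e) * (1 + e + 2 * a * c) / qmod a e c - (1 - e) / (1 + 2 * a + e) =
  (1 - e) / (1 + 2 * a + e) * ((1 - c) * (w / qmod a e c)).
  have := lt0r_neq0 M0; rewrite /w /qmod => M00.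
  by field; rewrite M00 lt0r_neq0.
have d1 : `|(1 - e) / (1 + 2 * a + e)| <= 1.
  by rewrite normrM normfV (gtr0_norm D0) ler_pdivrMr// mul1r ler_norml; apply/andP; split; lra.
rewrite normrM (ger0_norm (_ : 0 <= (1 - c) * (w / qmod a e c))); last first.
  by rewrite mulr_ge0 ?divr_ge0 ?(ltW M0)//; lra.
apply: (@le_trans _ _ ((1 - c) * (w / qmod a e c))).
  by rewrite ler_piMl// mulr_ge0 ?divr_ge0 ?(ltW M0)//; lra.
have h : w / qmod a e c <= 2 * qvar a e / c ^+ 2.
  have -> : 2 * qvar a e / c ^+ 2 = 2 * (2 * a * (1 + e) + 4 * e) / (c ^+ 2 * (1 + 2 * a + e) ^+ 2).
    by rewrite /qvar; field; rewrite !lt0r_neq0//; lra.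
  apply: ler_pM => //; first by rewrite invr_ge0 ltW.
  by rewrite lef_pV2// posrE mulr_gt0.
(* The bound c^2 >= 9 / 25 gives 50 / 9 <= 28 / 5, which 1 - c <= th^2 / 2 halves to 14 / 5. *)
have h2 : 2 * qvar a e / c ^+ 2 <= 28 / 5 * qvar a e.
  have c9 : 9 / 25 <= c ^+ 2.
    have -> : 9 / 25 = (3 / 5 : R) ^+ 2 by field.
    by rewrite ler_sqr// nnegrE; lra.
  by rewrite ler_pdivrMr// [leRHS]mulrAC; apply: ler_wpM2r => //; lra.
have -> : 14 / 5 * (qvar a e * th ^+ 2) = th ^+ 2 / 2 * (28 / 5 * qvar a e) by field.
apply: ler_pM => //; first lra.
  by rewrite divr_ge0 ?(ltW M0).
exact: le_trans h h2.
Qed.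

End quadratic_factor.

(** * From the logarithmic derivative to the Gaussian *)

Section logarithmic_derivative.
Context {R : realType}.
Variables (g1 g2 x y : R -> R) (V k del : R).
Hypothesis V0 : 0 <= V.
Hypothesis k0 : 0 <= k.
Hypothesis g10 : g1 0 = 1.
Hypothesis g20 : g2 0 = 0.
Hypothesis dg1 : forall t, 0 <= t <= del ->
  is_derive t 1 g1 (g1 t * x t - g2 t * y t).
Hypothesis dg2 : forall t, 0 <= t <= del ->
  is_derive t 1 g2 (g1 t * y t + g2 t * x t).
Hypothesis xy_le : forall t, 0 <= t <= del ->
  (x t + V * t) ^+ 2 + y t ^+ 2 <= (k * V * t ^+ 2) ^+ 2.

(** With g = g1 + i g2 and l = x + i y, the hypotheses read g' = l g and |l + V t| <= k V t^2.
    Multiplying g by [E] removes the expected Gaussian, and [B] is the exponential of the integrated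
    error. *)
Let E (t : R) := expR (V * t ^+ 2 / 2).
Let B (t : R) := expR (k * V * t ^+ 3 / 3).

(** The squared modulus of E g has logarithmic derivative 2 (x + V u) <= 2 k V u^2, so its quotient
    by B^2 does not increase. *)
Let r_le t : 0 <= t <= del -> (g1 t * E t) ^+ 2 + (g2 t * E t) ^+ 2 <= B t ^+ 2.
Proof.
move=> /andP[t0 td].
have C0 : 0 < expR (- (2 * k * V * t ^+ 3 / 3)) by exact: expR_gt0.
have h := @derive_le_seg R
  (fun u => ((g1 u * expR (V * u ^+ 2 / 2)) ^+ 2 +
     (g2 u * expR (V * u ^+ 2 / 2)) ^+ 2) * expR (- (2 * k * V * u ^+ 3 / 3)))
  (fun u => 2 * ((x u + V * u) - k * V * u ^+ 2) *
     ((g1 u * expR (V * u ^+ 2 / 2)) ^+ 2 +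
     (g2 u * expR (V * u ^+ 2 / 2)) ^+ 2) * expR (- (2 * k * V * u ^+ 3 / 3)))
  (fun=> 0) (fun=> 0) 0 t t0.
have {}h : ((g1 t * E t) ^+ 2 + (g2 t * E t) ^+ 2) *
    expR (- (2 * k * V * t ^+ 3 / 3)) <= 1.
  have : forall a b : R, a - b <= 0 - 0 -> b = 1 -> a <= 1 by move=> a b; lra.
  apply; first apply: h.
  - move=> u /andP[u0 ut].
    have ud : 0 <= u <= del by rewrite u0 (le_trans ut).
    by have h1 := dg1 ud; have h2 := dg2 ud; der; field.
  - move=> u /andP[u0 ut].
    have ud : 0 <= u <= del by rewrite !ltW// (lt_le_trans ut).
    rewrite -mulrA mulr_le0_ge0//; last first.
      by apply: mulr_ge0; rewrite ?expR_ge0// addr_ge0 ?sqr_ge0.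
    suff : x u + V * u <= k * V * u ^+ 2 by lra.
    have K0 : 0 <= k * V * u ^+ 2 by rewrite mulr_ge0 ?sqr_ge0 ?(mulr_ge0 k0 V0).
    rewrite -(ger0_norm K0); apply: (le_trans (ler_norm _)).
    rewrite -(@ler_pXn2r _ 2)// ?nnegrE// !real_normK ?num_real//.
    by apply: le_trans (xy_le ud); rewrite lerDl sqr_ge0.
  - by rewrite g10 g20 !expr0n/= !mulr0 !mul0r oppr0 !expR0 !mulr1 expr1n expr0n addr0.
have -> : B t ^+ 2 = expR (2 * k * V * t ^+ 3 / 3).
  by rewrite /B expr2 -expRD; congr expR; field.
by rewrite -[leRHS]mul1r -ler_pdivrMr ?expR_gt0// -expRN.
Qed.

(** A projection of g - exp (- V t^2 / 2) on the unit vector (w1, w2). The derivative (l + V u) E g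
    of E g has modulus at most k V u^2 B, the derivative of B; increments from 0 are compared, then
    divided by E. *)
Lemma logderiv_gauss_le w1 w2 t : w1 ^+ 2 + w2 ^+ 2 = 1 -> 0 <= t <= del ->
  w1 * (g1 t - expR (- (V * t ^+ 2 / 2))) + w2 * g2 t <=
  expR (- (V * t ^+ 2 / 2)) * (expR (k * V * t ^+ 3 / 3) - 1).
Proof.
move=> w12 /andP[t0 td].
have h := @derive_le_seg R
  (fun u => w1 * (g1 u * expR (V * u ^+ 2 / 2)) + w2 * (g2 u * expR (V * u ^+ 2 / 2)))
  (fun u => w1 * (g1 u * (x u + V * u) - g2 u * y u) * expR (V * u ^+ 2 / 2) +
     w2 * (g1 u * y u + g2 u * (x u + V * u)) * expR (V * u ^+ 2 / 2))
  (fun u => expR (k * V * u ^+ 3 / 3))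
  (fun u => k * V * u ^+ 2 * expR (k * V * u ^+ 3 / 3)) 0 t t0.
have {}h : w1 * (g1 t * E t) + w2 * (g2 t * E t) - w1 <= B t - 1.
  have : forall a b c d : R, a - b <= c - d -> b = w1 -> d = 1 -> a - w1 <= c - 1.
    by move=> a b c d; lra.
  apply; first apply: h.
  - move=> u /andP[u0 ut].
    have ud : 0 <= u <= del by rewrite u0 (le_trans ut).
    by have h1 := dg1 ud; have h2 := dg2 ud; der; field.
  - by move=> u _; der; field.
  - move=> u /andP[u0 ut].
    have ud : 0 <= u <= del by rewrite !ltW// (lt_le_trans ut).
    have K0 : 0 <= k * V * u ^+ 2 by rewrite mulr_ge0 ?sqr_ge0 ?(mulr_ge0 k0 V0).
    have KB0 : 0 <= k * V * u ^+ 2 * B u by rewrite mulr_ge0 ?expR_ge0.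
    rewrite -/(B u) -(ger0_norm KB0); apply: (le_trans (ler_norm _)).
    rewrite -(@ler_pXn2r _ 2)// ?nnegrE// !real_normK ?num_real//.
    rewrite [leRHS]exprMn.
    apply: (@le_trans _ _ (((x u + V * u) ^+ 2 + y u ^+ 2) *
       ((g1 u * E u) ^+ 2 + (g2 u * E u) ^+ 2))); last first.
      by apply: ler_pM; rewrite ?addr_ge0 ?sqr_ge0 ?xy_le ?r_le.
    rewrite -[leRHS]mul1r -[X in _ <= X * _]w12 -subr_ge0 /E.
    move: (expR _) (x u + _) (y u) (g1 u) (g2 u) => e X Y a b.
    (* Lagrange's identity: the defect in the Cauchy-Schwarz inequality is a square. *)
    have -> : (w1 ^+ 2 + w2 ^+ 2) * ((X ^+ 2 + Y ^+ 2) * ((a * e) ^+ 2 + (b * e) ^+ 2)) -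
      (w1 * (a * X - b * Y) * e + w2 * (a * Y + b * X) * e) ^+ 2
      = (w1 * (a * Y + b * X) * e - w2 * (a * X - b * Y) * e) ^+ 2 by ring.
    exact: sqr_ge0.
  - by rewrite g10 g20 !expr0n/= !mulr0 !mul0r !expR0 !mulr1 mulr0 addr0.
  - by rewrite expr0n/= !mulr0 mul0r expR0.
have EE : E t * expR (- (V * t ^+ 2 / 2)) = 1 by rewrite -expRD subrr expR0.
have := ler_wpM2r (expR_ge0 (- (V * t ^+ 2 / 2))) h.
rewrite [leRHS]mulrC; apply: le_trans.
rewrite le_eqVlt; apply/orP; left; apply/eqP.
have -> : (w1 * (g1 t * E t) + w2 * (g2 t * E t) - w1) * expR (- (V * t ^+ 2 / 2)) =
  (w1 * g1 t + w2 * g2 t) * (E t * expR (- (V * t ^+ 2 / 2))) -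
     w1 * expR (- (V * t ^+ 2 / 2)) by ring.
by rewrite EE; ring.
Qed.

End logarithmic_derivative.

(** * The characteristic function of the coefficients *)

Section product_of_linear_factors.
Context {F : fieldType} {I : Type}.
Variables (c : I -> F) (z : F).
Hypothesis zc : forall i, z + c i != 0.

Let P (r : seq I) : {poly F} := \prod_(i <- r) ('X + (c i)%:P).

Let derivXDc i : ('X + (c i)%:P)^`() = 1 :> {poly F}.
Proof. by rewrite derivD derivX derivC addr0. Qed.

Let hornerXDc i : ('X + (c i)%:P).[z] = z + c i.
Proof. by rewrite hornerD hornerX hornerC. Qed.

Lemma deriv_prod_XDc (r : seq I) : (P r)^`().[z] = (P r).[z] * \sum_(i <- r) (z + c i)^-1.
Proof.
rewrite /P; elim: r => [|i s IH]; first by rewrite !big_nil mulr0 derivC hornerC.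
rewrite !big_cons derivM derivXDc mul1r hornerD !hornerM IH hornerXDc.
by field; exact: zc.
Qed.

(** P'' / P = (P' / P)^2 + (P' / P)', where P' / P is the sum of the 1 / (z + c i). *)
Lemma deriv2_prod_XDc (r : seq I) : (P r)^`()^`().[z] = (P r).[z] *
  ((\sum_(i <- r) (z + c i)^-1) ^+ 2 - \sum_(i <- r) (z + c i)^-1 ^+ 2).
Proof.
elim: r => [|i s IH].
  by rewrite /P !big_nil !derivC hornerC subr0 expr0n/= mulr0.
have D1 := deriv_prod_XDc s; rewrite /P in D1 IH *.
rewrite !big_cons derivM derivXDc mul1r derivD derivM derivXDc mul1r.
rewrite !hornerD !hornerM IH D1 hornerXDc.
by field; exact: zc.
Qed.

End product_of_linear_factors.

(** * The quadratic factors on the unit circle *)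

Section unit_circle.
Context {R : realType}.
Local Open Scope complex_scope.
Implicit Types t u : R.

Definition cis t : R[i] := cos t +i* sin t.

Lemma cisD t u : cis (t + u) = cis t * cis u.
Proof. by rewrite /cis cosD sinD; congr (_ +i* _); rewrite addrC. Qed.

Lemma cis0 : cis 0 = 1. Proof. by rewrite /cis cos0 sin0. Qed.

Lemma cisMn (n : nat) t : cis (n%:R * t) = cis t ^+ n.
Proof.
elim: n => [|n IH]; first by rewrite mul0r cis0 expr0.
by rewrite -natr1 mulrDl mul1r addrC cisD IH exprS.
Qed.

Lemma normc_cis t : ComplexField.Normc.normc (cis t) = 1.
Proof. by rewrite /cis /= cos2Dsin2 sqrtr1. Qed.

Lemma complex_sum (n : nat) (f g : 'I_n -> R) :
  (\sum_i f i) +i* (\sum_i g i) = \sum_i (f i +i* g i).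
Proof.
elim: n f g => [|n IH] f g; first by rewrite !big_ord0.
by rewrite !big_ord_recl -IH.
Qed.

Lemma cis_add_neq0 t (z : R[i]) : 0 < cos t -> 0 <= complex.Re z -> cis t + z != 0.
Proof.
move=> c0; case: z => a b /= a0; rewrite eq_complex negb_and /=.
by apply/orP; left; apply: lt0r_neq0; exact: ltr_pwDl.
Qed.

Lemma normc_q_cis t (a b : R) :
  ComplexField.Normc.normc ((cis t + (a +i* b)) * (cis t + (a -i* b))) ^+ 2 =
  qmod a (a ^+ 2 + b ^+ 2) (cos t).
Proof.
have cs : sin t ^+ 2 = 1 - cos t ^+ 2 by rewrite -(cos2Dsin2 t) addrC addKr.
rewrite /cis /= sqr_sqrtr ?addr_ge0 ?sqr_ge0// /qmod.
move: (cos t) (sin t) cs => c s cs.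
by ring: cs.
Qed.

(** The cross-multiplied form of [q_cisE] in free variables, so that [field] can use the two
    equations as rewriting rules. *)
Let q_cis_aux (a b c s M : R) (e := a ^+ 2 + b ^+ 2) :
  M != 0 -> s ^+ 2 = 1 - c ^+ 2 ->
  M = (1 + 2 * a + e) ^+ 2 - 4 * a * (1 + e) * (1 - c) - 4 * e * (1 - c ^+ 2) ->
  (c +i* s) * (c +i* s + (a -i* b) + (c +i* s + (a +i* b))) =
  (1 + ((1 - e) * (1 + e + 2 * a * c) / M) +i*
      (s * (2 * a * (1 + e) + 4 * e * c) / M)) *
  ((c +i* s + (a +i* b)) * (c +i* s + (a -i* b))).
Proof.
rewrite /e => {e} M0 cs ME.
by apply/eqP; rewrite eq_complex; apply/andP; split; apply/eqP => /=; field: cs ME.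
Qed.

(** The left side is z q'(z) / q(z) at z = cis t, put over the real denominator |q(z)|^2. The
    conditions 0 < cos t and 0 <= a keep z away from the roots. *)
Lemma q_cisE t (a b : R) (e := a ^+ 2 + b ^+ 2) :
  0 < cos t -> 0 <= a -> 
  cis t / (cis t + (a +i* b)) + cis t / (cis t + (a -i* b)) =
  1 + ((1 - e) * (1 + e + 2 * a * cos t) / qmod a e (cos t)) +i*
      (sin t * (2 * a * (1 + e) + 4 * e * cos t) / qmod a e (cos t)).
Proof.
move=> c0 a0.
have cs : sin t ^+ 2 = 1 - cos t ^+ 2 by rewrite -(cos2Dsin2 t) addrC addKr.
have h1 := @cis_add_neq0 t (a +i* b) c0 a0.
have h2 := @cis_add_neq0 t (a -i* b) c0 a0.
have M0 : qmod a e (cos t) != 0.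
  rewrite /e -normc_q_cis expf_neq0//.
  by apply: contra_neq (mulf_neq0 h1 h2) => /ComplexField.Normc.eq0_normc.
rewrite addf_div// -mulrDr; apply: (mulIf (mulf_neq0 h1 h2)).
rewrite divfK ?mulf_neq0//; exact: q_cis_aux.
Qed.

End unit_circle.

(** * Moments of the coefficients as derivatives *)

Section polynomial_moments.
Context {K : comNzRingType}.
Implicit Types (q : {poly K}) (z : K).

Lemma horner_deriv_coef q n z : (size q <= n.+1)%N ->
  z * q^`().[z] = \sum_(m < n.+1) m%:R * q`_m * z ^+ m.
Proof.
move=> sq; rewrite big_ord_recl !mul0r add0r.
have sq' : (size q^`() <= n)%N.
  have [->|q0] := eqVneq q 0; first by rewrite derivC size_poly0.
  by rewrite -ltnS (leq_trans (lt_size_deriv q0)).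
rewrite (horner_coef_wide _ sq') big_distrr/=; apply: eq_bigr => i _.
by rewrite /bump leq0n add1n coef_deriv exprS -mulr_natl; ring.
Qed.

Lemma horner_deriv2_coef q n : (size q <= n.+1)%N ->
  q^`()^`().[1] = \sum_(m < n.+1) (m%:R ^+ 2 - m%:R) * q`_m.
Proof.
move=> sq; rewrite big_ord_recl expr0n/= subrr mul0r add0r.
have sq' : (size q^`() <= n)%N.
  have [->|q0] := eqVneq q 0; first by rewrite derivC size_poly0.
  by rewrite -ltnS (leq_trans (lt_size_deriv q0)).
rewrite -[LHS]mul1r (horner_deriv_coef _ (leq_trans sq' (leqnSn n))).
(* The first-derivative formula sums up to index n, where q' has coefficient 0 because its size is
   at most n. *)
rewrite big_ord_recr/= expr1n mulr1 (nth_default 0 sq') mulr0 addr0.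
apply: eq_bigr => i _.
by rewrite /bump leq0n add1n coef_deriv expr1n -mulr_natl -natr1; ring.
Qed.

End polynomial_moments.

(** * Mean, variance and characteristic function in terms of the roots *)

Section characteristic_function.
Context {R : realType}.
Local Open Scope complex_scope.
Variables (N : nat) (p : {poly R}) (eta : 'I_N -> R[i]).
Hypothesis hdeg : size p = N.+1.
Hypothesis hp : forall m : nat, 0 <= p`_m.
Hypothesis hpN : 0 < p`_N.
Hypothesis hfact : map_poly (real_complex R) p =
  (real_complex R p`_N) *: \prod_(j < N) ('X + (eta j)%:P).
Hypothesis heta : forall j : 'I_N, 0 <= complex.Re (eta j).

Let P := map_poly (real_complex R) p.

Definition prob (m : nat) : R := p`_m / p.[1].
Definition mean : R := \sum_(m < N.+1) m%:R * prob m.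
Definition var : R := \sum_(m < N.+1) (m%:R - mean) ^+ 2 * prob m.
(** Real and imaginary parts of E[exp (i (X - mean) t)], the centring making the logarithmic
    derivative vanish at 0. *)
Definition chf_re (t : R) : R := \sum_(m < N.+1) prob m * cos ((m%:R - mean) * t).
Definition chf_im (t : R) : R := \sum_(m < N.+1) prob m * sin ((m%:R - mean) * t).

(** The parameters a and e of the quadratic factor with roots - eta j and its conjugate. *)
Definition root_re (j : 'I_N) : R := complex.Re (eta j).
Definition root_sqn (j : 'I_N) : R := complex.Re (eta j) ^+ 2 + complex.Im (eta j) ^+ 2.

Lemma horner1_gt0 : 0 < p.[1].
Proof.
rewrite horner_coef hdeg big_ord_recr/= expr1n mulr1 ltr_wpDl//.
by apply: sumr_ge0 => i _; rewrite expr1n mulr1.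
Qed.

Lemma sum_prob : \sum_(m < N.+1) prob m = 1.
Proof.
rewrite -mulr_suml; have -> : \sum_(m < N.+1) p`_m = p.[1].
  by rewrite horner_coef hdeg; apply: eq_bigr => i _; rewrite expr1n mulr1.
by rewrite divff// lt0r_neq0// horner1_gt0.
Qed.

Lemma prob_ge0 m : 0 <= prob m.
Proof. by rewrite divr_ge0// ltW// horner1_gt0. Qed.

Lemma meanE : mean = p^`().[1] / p.[1].
Proof.
rewrite -[p^`().[1]]mul1r (@horner_deriv_coef _ p N) ?hdeg// mulr_suml.
by apply: eq_bigr => i _; rewrite expr1n mulr1 mulrA.
Qed.

Lemma varE : var = p^`()^`().[1] / p.[1] + mean - mean ^+ 2.
Proof.
rewrite (@horner_deriv2_coef _ p N) ?hdeg// mulr_suml.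
have e : \sum_(i < N.+1) (i%:R ^+ 2 - i%:R) * p`_i / p.[1] =
   \sum_(i < N.+1) i%:R ^+ 2 * prob i - mean.
  by rewrite /mean -sumrB; apply: eq_bigr => i _; rewrite /prob; ring.
rewrite e subrK /var.
transitivity (\sum_(m < N.+1) (m%:R ^+ 2 * prob m - 2 * mean * (m%:R * prob m) +
   mean ^+ 2 * prob m)).
  by apply: eq_bigr => i _; ring.
rewrite big_split sumrB/= -!mulr_sumr sum_prob -/mean; ring.
Qed.

Lemma complex_ReD (x y : R[i]) : complex.Re (x + y) = complex.Re x + complex.Re y.
Proof. by case: x y => [? ?] []. Qed.

(** Real coefficients make P invariant under conjugation. *)
Lemma conj_fact : P = (p`_N)%:C *: \prod_(j < N) ('X + (conjc (eta j))%:P).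
Proof.
have -> : P = map_poly conjc P.
  by apply/polyP => i; rewrite !coef_map/= oppr0.
rewrite /P hfact map_polyZ/= oppr0 rmorph_prod; congr (_ *: _).
by apply: eq_bigr => j _; rewrite rmorphD/= map_polyX map_polyC.
Qed.

Lemma one_eta_neq0 j : 1 + eta j != 0.
Proof. by rewrite -cis0 cis_add_neq0// cos0. Qed.

Lemma P_logderiv z : (forall j, z + eta j != 0) ->
  P^`().[z] = P.[z] * \sum_j (z + eta j)^-1.
Proof.
move=> h; rewrite /P hfact derivZ !hornerZ deriv_prod_XDc// mulrA.
by congr (_ * _); rewrite hornerZ.
Qed.

Lemma P_logderiv_conj z : (forall j, z + conjc (eta j) != 0) ->
  P^`().[z] = P.[z] * \sum_j (z + conjc (eta j))^-1.
Proof. by move=> h; rewrite conj_fact derivZ !hornerZ deriv_prod_XDc// mulrA. Qed.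

Lemma P_horner1 : P.[1] = (p.[1])%:C.
Proof. by rewrite /P -(rmorph1 (real_complex R)) horner_map. Qed.

Lemma P_horner1_neq0 : P.[1] != 0.
Proof. by rewrite P_horner1 fmorph_eq0 lt0r_neq0// horner1_gt0. Qed.

Lemma mean_complex : mean%:C = \sum_j (1 + eta j)^-1.
Proof.
rewrite meanE rmorphM/= fmorphV/= -P_horner1.
have -> : (p^`().[1])%:C = P^`().[1].
  by rewrite /P deriv_map -(rmorph1 (real_complex R)) horner_map.
rewrite (P_logderiv one_eta_neq0) mulrC mulKf//; exact: P_horner1_neq0.
Qed.

(** Real parts of [mean_complex]. The shape copies the real part in [q_cisE], so that the two cancel
    termwise in [logderE]. *)
Lemma mean_roots : mean = 2^-1 * \sum_j (1 + (1 - root_sqn j) /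
  (1 + 2 * root_re j + root_sqn j)).
Proof.
have -> : mean = complex.Re mean%:C by [].
rewrite mean_complex (big_morph _ complex_ReD (erefl : complex.Re 0 = 0)) mulr_sumr.
apply: eq_bigr => j _.
rewrite /root_re /root_sqn; have := heta j; case: (eta j) => a b /= a0.
have b2 := sqr_ge0 b; have a2 := sqr_ge0 a.
by field; apply: lt0r_neq0; lra.
Qed.

(** In P'' / P + P' / P - (P' / P)^2 at 1 the squared sums cancel. *)
Lemma var_complex : var%:C = \sum_j ((1 + eta j)^-1 - (1 + eta j)^-1 ^+ 2).
Proof.
rewrite varE rmorphB rmorphD rmorphXn rmorphM/= fmorphV/= -P_horner1 mean_complex.
have -> : (p^`()^`().[1])%:C = P^`()^`().[1].
  by rewrite /P !deriv_map -(rmorph1 (real_complex R)) horner_map.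
have -> : P^`()^`().[1] = P.[1] * ((\sum_j (1 + eta j)^-1) ^+ 2 -
   \sum_j (1 + eta j)^-1 ^+ 2).
  rewrite /P hfact !derivZ !hornerZ deriv2_prod_XDc ?mulrA//.
  exact: one_eta_neq0.
rewrite [X in X + _ - _]mulrC mulKf; last exact: P_horner1_neq0.
by rewrite sumrB; ring.
Qed.

(** Real parts of [var_complex]: each root contributes half the variance of the quadratic factor of
    its conjugate pair. *)
Lemma var_roots : var = 2^-1 * \sum_j qvar (root_re j) (root_sqn j).
Proof.
have -> : var = complex.Re var%:C by [].
rewrite var_complex (big_morph _ complex_ReD (erefl : complex.Re 0 = 0)) mulr_sumr.
apply: eq_bigr => j _.
rewrite /root_re /root_sqn /qvar; have := heta j; case: (eta j) => a b /= a0.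
have b2 := sqr_ge0 b; have a2 := sqr_ge0 a.
by field; apply: lt0r_neq0; lra.
Qed.

Lemma chfE t : chf_re t +i* chf_im t = cis (- (mean * t)) * (P.[cis t] / P.[1]).
Proof.
rewrite complex_sum (@horner_coef_wide _ N.+1 P (cis t)) ?size_map_poly ?hdeg//.
rewrite [X in _ = _ * X]mulr_suml [RHS]mulr_sumr; apply: eq_bigr => m _.
have -> : prob m * cos ((m%:R - mean) * t) +i* (prob m * sin ((m%:R - mean) * t)) =
  (prob m)%:C * cis ((m%:R - mean) * t).
  by rewrite /cis /real_complex_def; congr (_ +i* _); rewrite !mul0r ?subr0 ?addr0.
rewrite mulrBl addrC cisD cisMn coef_map/= P_horner1 /prob rmorphM/= fmorphV/=.
by ring.
Qed.

Definition dchf_re (t : R) : R :=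
  \sum_(m < N.+1) - (prob m * ((m%:R - mean) * sin ((m%:R - mean) * t))).
Definition dchf_im (t : R) : R :=
  \sum_(m < N.+1) prob m * ((m%:R - mean) * cos ((m%:R - mean) * t)).

Lemma is_derive_chf_re (t : R) : is_derive t 1 chf_re (dchf_re t).
Proof. by apply: is_derive_psum => m; der; ring. Qed.

Lemma is_derive_chf_im (t : R) : is_derive t 1 chf_im (dchf_im t).
Proof. by apply: is_derive_psum => m; der; ring. Qed.

Lemma dchfE t : dchf_re t +i* dchf_im t =
  'i * (cis (- (mean * t)) * ((cis t * P^`().[cis t] - mean%:C * P.[cis t]) / P.[1])).
Proof.
rewrite complex_sum (@horner_deriv_coef _ _ N) ?size_map_poly ?hdeg//.
rewrite (@horner_coef_wide _ N.+1 P (cis t)) ?size_map_poly ?hdeg// [X in _ - X]mulr_sumr -sumrB.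
rewrite [X in _ = _ * (_ * X)]mulr_suml [X in _ = _ * X]mulr_sumr [RHS]mulr_sumr.
apply: eq_bigr => m _.
set w := m%:R - mean.
have -> : - (prob m * (w * sin (w * t))) +i* (prob m * (w * cos (w * t))) =
  'i * ((prob m)%:C * w%:C * cis (w * t)).
  by rewrite /cis /real_complex_def; apply/eqP; rewrite eq_complex;
    apply/andP; split; apply/eqP => /=; ring.
rewrite {2}/w mulrBl addrC cisD cisMn coef_map/= P_horner1 /prob /w rmorphM/= fmorphV/=.
by rewrite rmorphB rmorph_nat; ring.
Qed.

(** Real and imaginary parts of i (z P'(z) / P(z) - mean) at z = cis t, the logarithmic derivative
    of the centred characteristic function. The factor i exchanges the two parts and produces the
    sign here. *)
Definition logder_re (t : R) : R := - (2^-1 * \sum_j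
  sin t * (2 * root_re j * (1 + root_sqn j) + 4 * root_sqn j * cos t) /
    qmod (root_re j) (root_sqn j) (cos t)).
Definition logder_im (t : R) : R := 2^-1 * \sum_j
  ((1 - root_sqn j) * (1 + root_sqn j + 2 * root_re j * cos t) /
     qmod (root_re j) (root_sqn j) (cos t) -
   (1 - root_sqn j) / (1 + 2 * root_re j + root_sqn j)).

(* Averaging over the roots and their conjugates keeps the logarithmic derivative
   comparable to the variance when the roots are close to the imaginary axis. *)
Lemma logderE t : 0 < cos t ->
  'i * (cis t * P^`().[cis t] - mean%:C * P.[cis t]) =
  P.[cis t] * (logder_re t +i* logder_im t).
Proof.
move=> c0.
have h1 := P_logderiv (fun j => cis_add_neq0 c0 (heta j)).
have h2' j : 0 <= complex.Re (conjc (eta j)) by have := heta j; case: (eta j).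
have h2 := P_logderiv_conj (fun j => cis_add_neq0 c0 (h2' j)).
have -> : P^`().[cis t] = 2^-1 * (P.[cis t] * \sum_j (cis t + eta j)^-1 +
    P.[cis t] * \sum_j (cis t + conjc (eta j))^-1).
  by rewrite -h1 -h2; field.
have -> : 'i * (cis t * (2^-1 * (P.[cis t] * \sum_j (cis t + eta j)^-1 +
    P.[cis t] * \sum_j (cis t + conjc (eta j))^-1)) - mean%:C * P.[cis t]) =
  P.[cis t] * ('i * (2^-1 * \sum_j (cis t / (cis t + eta j) +
     cis t / (cis t + conjc (eta j))) - mean%:C)).
  by rewrite big_split/= -!mulr_sumr; ring.
congr (_ * _).
rewrite mean_roots /logder_re /logder_im.
have -> : \sum_j (cis t / (cis t + eta j) + cis t / (cis t + conjc (eta j))) =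
   \sum_j ((1 + ((1 - root_sqn j) * (1 + root_sqn j + 2 * root_re j * cos t) /
     qmod (root_re j) (root_sqn j) (cos t))) +i* 
    (sin t * (2 * root_re j * (1 + root_sqn j) + 4 * root_sqn j * cos t) /
    qmod (root_re j) (root_sqn j) (cos t))).
  apply: eq_bigr => j _; rewrite /root_re /root_sqn; have := heta j.
  by case: (eta j) => a b /= a0; rewrite q_cisE//; apply/eqP; rewrite eq_complex/= add0r !eqxx.
rewrite -complex_sum.
have -> : (2^-1 : R[i]) = (2^-1 : R)%:C by rewrite fmorphV rmorph_nat.
rewrite /real_complex_def; apply/eqP; rewrite eq_complex; apply/andP; split; apply/eqP => /=.
  by ring.
by rewrite !sumrB !big_split/=; ring.
Qed.

Lemma chf_logder t : 0 < cos t ->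
  dchf_re t = chf_re t * logder_re t - chf_im t * logder_im t /\
  dchf_im t = chf_re t * logder_im t + chf_im t * logder_re t.
Proof.
move=> c0; suff : dchf_re t +i* dchf_im t =
    (chf_re t +i* chf_im t) * (logder_re t +i* logder_im t).
  by move=> [-> ->].
rewrite dchfE chfE -mulrA.
have -> : P.[cis t] / P.[1] * (logder_re t +i* logder_im t) =
  (P.[cis t] * (logder_re t +i* logder_im t)) / P.[1] by ring.
by rewrite -logderE//; ring.
Qed.

Let normc : R[i] -> R := @ComplexField.Normc.normc R.

(** One copy of P is factored over the roots and another over their conjugates, so P^2 is a product
    of quadratic factors; squaring the modulus again produces [qmod]. *)
Lemma normc_P_cis t : normc P.[cis t] ^+ 4 =
  normc (p`_N)%:C ^+ 4 * \prod_j qmod (root_re j) (root_sqn j) (cos t).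
Proof.
have h1 : P.[cis t] = (p`_N)%:C * \prod_j (cis t + eta j).
  by rewrite /P hfact hornerZ horner_prod; congr (_ * _); apply: eq_bigr => j _;
    rewrite hornerD hornerX hornerC.
have h2 : P.[cis t] = (p`_N)%:C * \prod_j (cis t + conjc (eta j)).
  by rewrite conj_fact hornerZ horner_prod; congr (_ * _); apply: eq_bigr => j _;
    rewrite hornerD hornerX hornerC.
have -> : normc P.[cis t] ^+ 4 = normc (P.[cis t] * P.[cis t]) ^+ 2.
  by rewrite /normc ComplexField.Normc.normcM; ring.
rewrite {1}h1 h2 mulrACA -big_split/=.
rewrite /normc !ComplexField.Normc.normcM exprMn -expr2 -exprM; congr (_ * _).
rewrite (big_morph _ (@ComplexField.Normc.normcM R) (@ComplexField.Normc.normc1 R)).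
rewrite -prodrXl; apply: eq_bigr => j _.
by rewrite /root_re /root_sqn; case: (eta j) => a b; rewrite normc_q_cis.
Qed.

Lemma root_sqn_ge j : root_re j ^+ 2 <= root_sqn j.
Proof. by rewrite lerDl sqr_ge0. Qed.

Lemma qmod_roots_ge0 j t : 0 <= qmod (root_re j) (root_sqn j) (cos t).
Proof.
rewrite /root_re /root_sqn; case: (eta j) => a b /=.
by rewrite -normc_q_cis sqr_ge0.
Qed.

Lemma weight_roots : 4 * weight eta = \sum_j root_re j / (1 + root_sqn j).
Proof.
rewrite /weight mulrA divff// mul1r; apply: eq_bigr => j _.
rewrite /root_re /root_sqn; case: (eta j) => a b /=.
by rewrite sqr_sqrtr// addr_ge0 ?sqr_ge0.
Qed.

(** The fourth power of the modulus is a product of ratios of [qmod] at cos t and at 1, each at most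
    1 - y <= exp (- y) by [qmod_le]; the exponents add up to the weight. *)
Lemma chf_decay t :
  (chf_re t ^+ 2 + chf_im t ^+ 2) ^+ 2 <= expR (- (4 * weight eta * (1 - cos t))).
Proof.
have e1 : chf_re t ^+ 2 + chf_im t ^+ 2 = normc (chf_re t +i* chf_im t) ^+ 2.
  by rewrite /normc/= sqr_sqrtr// addr_ge0 ?sqr_ge0.
rewrite e1 -exprM chfE /normc !ComplexField.Normc.normcM normc_cis mul1r.
rewrite ComplexField.Normc.normcV exprMn exprVn -cis0 -/normc !normc_P_cis cos0.
have c0 : 0 < normc (p`_N)%:C ^+ 4.
  by rewrite exprn_gt0// /normc/= expr0n/= addr0 sqrtr_sqr normr_gt0 lt0r_neq0.
have D0 j : 0 < 1 + 2 * root_re j + root_sqn j.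
  have := heta j; have := root_sqn_ge j; have := sqr_ge0 (root_re j).
  by rewrite -/(root_re j); lra.
have Q1 j : qmod (root_re j) (root_sqn j) 1 = (1 + 2 * root_re j + root_sqn j) ^+ 2.
  by rewrite /qmod expr1n subrr !mulr0 !subr0.
have Q0 : 0 < \prod_j qmod (root_re j) (root_sqn j) 1.
  by apply: prodr_gt0 => j _; rewrite Q1 exprn_gt0.
rewrite (ler_pdivrMr _ _ (mulr_gt0 c0 Q0)) mulrCA ler_pM2l// weight_roots mulr_suml -sumrN.
rewrite expR_sum -big_split/=; apply: ler_prod => j _; rewrite qmod_roots_ge0/=.
have ct : -1 <= cos t <= 1 by rewrite cos_geN1 cos_le1.
apply: (le_trans (qmod_le (heta j) (root_sqn_ge j) ct)).
rewrite Q1 mulrC ler_wpM2r ?sqr_ge0//.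
exact: expR_ge1Dx.
Qed.

End characteristic_function.

(** * The local limit estimate *)

Section numeric.
Context {R : realType}.
Implicit Types x : R.

Lemma expR_sub1_le x : expR x - 1 <= x * expR x.
Proof.
have h := expR_ge1Dx (- x); have := ler_wpM2r (expR_ge0 x) h.
by rewrite -expRD addNr expR0; lra.
Qed.

(** From exp (- 19 / 80) >= 61 / 80, raised to the fourth power. *)
Lemma expR_19_20_le3 : expR (19 / 20 : R) <= 3.
Proof.
have h : expR (19 / 20 : R) = expR (19 / 80) ^+ 4.
  by rewrite -expRM_natl; congr expR; field.
have e : expR (19 / 80 : R) <= 80 / 61.
  have h1 := expR_ge1Dx (- (19 / 80 : R)).
  have h2 := ler_wpM2r (expR_ge0 (19 / 80)) h1.
  by rewrite -expRD addNr expR0 in h2; lra.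
rewrite h; apply: (@le_trans _ _ ((80 / 61) ^+ 4)); last by lra.
by rewrite lerXn2r// nnegrE ?expR_ge0//; lra.
Qed.

Lemma sin_pi_int (n : int) : sin (n%:~R * pi) = 0 :> R.
Proof.
have h (k : nat) : sin (k%:R * pi) = 0 :> R.
  elim: k => [|k IH]; first by rewrite mul0r sin0.
  by rewrite -natr1 mulrDl mul1r sinDpi IH oppr0.
case: n => k; first exact: h.
by rewrite NegzE mulrNz mulNr sinN h oppr0.
Qed.

End numeric.

Section local_limit.
Context {R : realType}.
Variables (N : nat) (p : {poly R}) (eta : 'I_N -> R[i]).
Hypothesis hdeg : size p = N.+1.
Hypothesis hp : forall m : nat, 0 <= p`_m.
Hypothesis hpN : 0 < p`_N.
Hypothesis hfact : map_poly (real_complex R) p =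
  (real_complex R p`_N) *: \prod_(j < N) ('X + (eta j)%:P).
Hypothesis heta : forall j : 'I_N, 0 <= complex.Re (eta j).

Let v := var N p.
Let mu := mean N p.
Let w := weight eta.

(** The condition t^2 <= 4 / 5 gives t <= 9 / 10 and cos t >= 3 / 5, the ranges of [q_logderiv_re];
    its bounds sum to the variance by [var_roots]. *)
Lemma logder_re_le t : 0 <= t -> t ^+ 2 <= 4 / 5 ->
  `|logder_re eta t + v * t| <= 5 / 2 * (v * t ^+ 2).
Proof.
move=> t0 t2.
have t1 : t <= 9 / 10.
  rewrite leNgt; apply/negP => h; have : (9 / 10 : R) ^+ 2 < t ^+ 2.
    by rewrite ltr_pXn2r// ?nnegrE; lra.
  by lra.
have c1 := cos_ge_quadratic t0; have s1 := sin_ge_cubic t0; have s2 := sin_le_id t0.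
have s0 : 0 <= sin t.
  by apply: sin_ge0_pi; rewrite t0/=; have := pi_ge2 R; lra.
(* The Taylor bounds multiply to t - 2 t^3 / 3 + t^5 / 12, and t^3 <= 9 t^2 / 10. *)
have sc : t - t ^+ 2 <= sin t * cos t.
  apply: (@le_trans _ _ ((t - t ^+ 3 / 6) * (1 - t ^+ 2 / 2))).
    have t3 : t ^+ 3 = t * t ^+ 2 by ring.
    have h1 : t ^+ 3 <= 9 / 10 * t ^+ 2 by rewrite t3; apply: ler_wpM2r => //; exact: sqr_ge0.
    have h2 : 0 <= t ^+ 3 * t ^+ 2 by rewrite mulr_ge0 ?exprn_ge0.
    have -> : (t - t ^+ 3 / 6) * (1 - t ^+ 2 / 2) =
       t - t ^+ 3 * (2 / 3) + t ^+ 3 * t ^+ 2 / 12 by field.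
    have := sqr_ge0 t; lra.
  apply: ler_pM => //; last by lra.
  have t3 : t ^+ 3 = t * t ^+ 2 by ring.
  have h1 : t * t ^+ 2 <= t * 1 by apply: ler_wpM2l => //; lra.
  by lra.
have -> : logder_re eta t + v * t = - (2^-1 * \sum_j
  (sin t * (2 * root_re eta j * (1 + root_sqn eta j) + 4 * root_sqn eta j * cos t) /
    qmod (root_re eta j) (root_sqn eta j) (cos t)
   - qvar (root_re eta j) (root_sqn eta j) * t)).
  by rewrite /v (var_roots hdeg hp hpN hfact heta) /logder_re sumrB -mulr_suml; ring.
rewrite normrN normrM ger0_norm// /v (var_roots hdeg hp hpN hfact heta).
have -> : 5 / 2 * (2^-1 * (\sum_j qvar (root_re eta j) (root_sqn eta j)) * t ^+ 2) =
  2^-1 * \sum_j (5 / 2 * (qvar (root_re eta j) (root_sqn eta j) * t ^+ 2)).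
  by rewrite -mulr_sumr -mulr_suml; ring.
rewrite ler_pM2l//; apply: (le_trans (ler_norm_sum _ _ _)).
apply: ler_sum => j _; apply: q_logderiv_re => //.
- exact: heta.
- exact: root_sqn_ge.
- by rewrite t0.
- by rewrite cos_le1 andbT; lra.
- by rewrite s0.
- exact: cos2Dsin2.
Qed.

Lemma logder_im_le t : 0 <= t -> t ^+ 2 <= 4 / 5 ->
  `|logder_im eta t| <= 14 / 5 * (v * t ^+ 2).
Proof.
move=> t0 t2; have c1 := cos_ge_quadratic t0.
rewrite /logder_im normrM ger0_norm// /v (var_roots hdeg hp hpN hfact heta).
have -> : 14 / 5 * (2^-1 * (\sum_j qvar (root_re eta j) (root_sqn eta j)) * t ^+ 2) =
  2^-1 * \sum_j (14 / 5 * (qvar (root_re eta j) (root_sqn eta j) * t ^+ 2)).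
  by rewrite -mulr_sumr -mulr_suml; ring.
rewrite ler_pM2l//; apply: (le_trans (ler_norm_sum _ _ _)).
apply: ler_sum => j _; apply: q_logderiv_im => //.
- exact: heta.
- exact: root_sqn_ge.
- by rewrite cos_le1 andbT; lra.
- by lra.
Qed.

Lemma var_ge0 : 0 <= v.
Proof. by apply: sumr_ge0 => i _; rewrite mulr_ge0 ?sqr_ge0 ?(prob_ge0 hdeg hp hpN). Qed.

Lemma logder_le t : 0 <= t -> t ^+ 2 <= 4 / 5 ->
  (logder_re eta t + v * t) ^+ 2 + logder_im eta t ^+ 2 <= (4 * v * t ^+ 2) ^+ 2.
Proof.
move=> t0 t2; have v0 : 0 <= v * t ^+ 2 by rewrite mulr_ge0 ?sqr_ge0 ?var_ge0.
have h1 := logder_re_le t0 t2; have h2 := logder_im_le t0 t2.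
rewrite -(real_normK (num_real (logder_re eta t + v * t))).
rewrite -(real_normK (num_real (logder_im eta t))).
apply: (@le_trans _ _ ((5 / 2 * (v * t ^+ 2)) ^+ 2 + (14 / 5 * (v * t ^+ 2)) ^+ 2)).
  by apply: lerD; rewrite lerXn2r// nnegrE// mulr_ge0.
(* (5 / 2)^2 + (14 / 5)^2 = 14.09 <= 4^2. *)
by have := sqr_ge0 (v * t ^+ 2); rewrite !exprMn; lra.
Qed.

Variable m : int.
Let x : R := m%:~R - mu.

(** Beyond N the value is 0 as well, by the default value of the coefficients. *)
Definition coef_int : R := if m is Posz k then prob p k else 0.

(* A primitive of the integrand of Fourier inversion at [m]. *)
Definition inv_prim (t : R) : R := \sum_(k < N.+1) prob p k *
  (if k%:Z == m then t else sin ((k%:Z - m)%:~R * t) / (k%:Z - m)%:~R).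

Lemma inv_prim0 : inv_prim 0 = 0.
Proof. by apply: big1 => k _; case: ifP => _; rewrite ?mulr0 ?sin0 ?mul0r ?mulr0. Qed.

(** Orthogonality: sin ((k - m) pi) = 0 leaves only the term k = m. *)
Lemma inv_prim_pi : inv_prim pi = coef_int * pi.
Proof.
rewrite /inv_prim.
have e (k : nat) : prob p k * (if k%:Z == m then pi else
    sin ((k%:Z - m)%:~R * pi) / (k%:Z - m)%:~R) = if k%:Z == m then prob p k * pi else 0.
  by case: ifP => // _; rewrite sin_pi_int mul0r mulr0.
under eq_bigr do rewrite e; rewrite -big_mkcond/= /coef_int.
case: m => n; last by rewrite big_pred0 ?mul0r.
have [nN|Nn] := ltnP n N.+1.
  by rewrite (big_pred1 (Ordinal nN)).
rewrite big_pred0; first by rewrite /prob nth_default ?hdeg// !mul0r.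
by move=> k /=; apply/eqP => -[kn]; move: (ltn_ord k); rewrite kn ltnNge Nn.
Qed.

(** The integrand is the real part of exp (- i x t) times the centred characteristic function, since
    k - m = (k - mu) - x. *)
Lemma is_derive_inv_prim (t : R) : is_derive t 1 inv_prim
  (cos (x * t) * chf_re N p t + sin (x * t) * chf_im N p t).
Proof.
have -> : cos (x * t) * chf_re N p t + sin (x * t) * chf_im N p t =
  \sum_(k < N.+1) prob p k * cos ((k%:Z - m)%:~R * t).
  rewrite !mulr_sumr -big_split/=; apply: eq_bigr => k _.
  have -> : (k%:Z - m)%:~R * t = (k%:R - mu) * t - x * t.
    by rewrite /x intrB; ring.
  by rewrite cosB /mu; ring.
apply: is_derive_psum => k; have [km|km] := eqVneq k%:Z m.
  by rewrite km subrr mul0r cos0; der; ring.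
have k0 : (k%:Z - m)%:~R != 0 :> R by rewrite intr_eq0 subr_eq0.
by move: ((k%:Z - m)%:~R : R) k0 => q q0; der; field.
Qed.

(** A projection on a unit vector is at most the modulus, whose fourth power [chf_decay] bounds;
    then [cos_le_jordan] makes the exponent quadratic. *)
Lemma chf_proj_le (c s t : R) : c ^+ 2 + s ^+ 2 = 1 -> 0 <= t <= pi ->
  c * chf_re N p t + s * chf_im N p t <= expR (- (2 * w / pi ^+ 2 * t ^+ 2)).
Proof.
move=> cs tpi; set e := expR _.
have e0 : 0 <= e by exact: expR_ge0.
rewrite -(ger0_norm e0); apply: (le_trans (ler_norm _)).
rewrite -(@ler_pXn2r _ 4)// ?nnegrE//.
have w0 : 0 <= 4 * w.
  rewrite /w weight_roots; apply: sumr_ge0 => j _.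
  apply: divr_ge0; first exact: heta.
  by rewrite addr_ge0// addr_ge0 ?sqr_ge0.
apply: (@le_trans _ _ ((chf_re N p t ^+ 2 + chf_im N p t ^+ 2) ^+ 2)).
  have -> : `|c * chf_re N p t + s * chf_im N p t| ^+ 4 =
     ((c * chf_re N p t + s * chf_im N p t) ^+ 2) ^+ 2.
    by rewrite -(real_normK (num_real (_ + _))) -exprM.
  rewrite lerXn2r// ?nnegrE ?addr_ge0 ?sqr_ge0//.
  rewrite -[leRHS]mul1r -cs -subr_ge0.
  move: (chf_re N p t) (chf_im N p t) => a b.
  have -> : (c ^+ 2 + s ^+ 2) * (a ^+ 2 + b ^+ 2) - (c * a + s * b) ^+ 2 =
    (c * b - s * a) ^+ 2 by ring.
  exact: sqr_ge0.
apply: (le_trans (chf_decay hdeg hpN hfact heta t)).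
rewrite (ger0_norm e0) /e -expRM_natl ler_expR mulrN lerN2 -/w.
have := ler_wpM2l w0 (cos_le_jordan tpi); congr (_ <= _).
by rewrite -[4%:R]/(4 : R); ring.
Qed.

Lemma chf_at0 : chf_re N p 0 = 1 /\ chf_im N p 0 = 0.
Proof.
split; last by apply: big1 => k _; rewrite mulr0 sin0 mulr0.
rewrite -(sum_prob hdeg hp hpN); apply: eq_bigr => k _.
by rewrite mulr0 cos0 mulr1.
Qed.

(** The cutoff. In [llt_coef] the product v del^3 is the square root of 1 / 2, which the two
    rational bounds enclose. *)
Variable del : R.
Hypothesis del0 : 0 < del.
Hypothesis del2 : del ^+ 2 <= 4 / 5.
Hypothesis vdel_ge : 7 / 10 <= v * del ^+ 3.
Hypothesis vdel_le : v * del ^+ 3 <= 71 / 100.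

(** With k = 4 in [logderiv_gauss_le], the error exponent y = 4 v t^3 / 3 is below 19 / 20, so exp y
    - 1 <= y exp y <= 3 y. *)
Lemma chf_gauss_le (c s t : R) : c ^+ 2 + s ^+ 2 = 1 -> 0 <= t <= del ->
  c * (chf_re N p t - expR (- (v * t ^+ 2 / 2))) + s * chf_im N p t <=
  4 * v * t ^+ 3 * expR (- (v * t ^+ 2 / 2)).
Proof.
move=> cs tdel.
have small u : 0 <= u <= del -> u ^+ 2 <= 4 / 5.
  move=> /andP[u0 ud]; apply: le_trans del2.
  by rewrite lerXn2r// nnegrE// ltW.
have cpos u : 0 <= u <= del -> 0 < cos u.
  move=> ud; have := small u ud; case/andP: ud => u0 _.
  by have := cos_ge_quadratic u0; lra.
have [g10 g20] := chf_at0.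
have dre u : 0 <= u <= del -> is_derive u 1 (chf_re N p)
    (chf_re N p u * logder_re eta u - chf_im N p u * logder_im eta u).
  move=> ud; have [<- _] := chf_logder hdeg hp hpN hfact heta (cpos u ud).
  exact: is_derive_chf_re.
have dim u : 0 <= u <= del -> is_derive u 1 (chf_im N p)
    (chf_re N p u * logder_im eta u + chf_im N p u * logder_re eta u).
  move=> ud; have [_ <-] := chf_logder hdeg hp hpN hfact heta (cpos u ud).
  exact: is_derive_chf_im.
have lle u : 0 <= u <= del -> (logder_re eta u + v * u) ^+ 2 + logder_im eta u ^+ 2
    <= (4 * v * u ^+ 2) ^+ 2.
  by move=> ud; apply: logder_le; [case/andP: ud|exact: small].
have h := logderiv_gauss_le var_ge0 (ler0n _ 4) g10 g20 dre dim lle cs tdel.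
apply: (le_trans h); rewrite [leRHS]mulrC; apply: ler_wpM2l; first exact: expR_ge0.
apply: (le_trans (expR_sub1_le _)).
case/andP: tdel => t0 td.
have t3 : v * t ^+ 3 <= 71 / 100.
  apply: le_trans vdel_le; apply: ler_wpM2l; first exact: var_ge0.
  by rewrite lerXn2r// nnegrE// ltW.
have y0 : 0 <= 4 * v * t ^+ 3 / 3.
  by rewrite !(mulr_ge0, divr_ge0) ?exprn_ge0 ?var_ge0.
apply: (@le_trans _ _ (4 * v * t ^+ 3 / 3 * 3)).
  apply: ler_wpM2l => //; apply: le_trans expR_19_20_le3; rewrite ler_expR.
  by lra.
by rewrite divfK.
Qed.

(** Up to the factor pi, the difference splits at [del] into the discrepancy below it (8 / v), the
    tail of the inversion integral (the exponential term) and the Gaussian tail (3 / v). *)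
Lemma llt_real : 0 < w -> 0 < v ->
  `|coef_int - gauss_density mu v m%:~R| <=
  pi / (4 * w * del) * expR (- (2 * w / pi ^+ 2 * del ^+ 2)) + 11 / (pi * v).
Proof.
move=> w0 v0; have pi0 := pi_gt0 R; have pi2 := pi_ge2 R.
have del_le_pi : del <= pi.
  apply: le_trans pi2; rewrite leNgt; apply/negP => h.
  have : (2 : R) ^+ 2 < del ^+ 2 by rewrite ltr_pXn2r// ?nnegrE; lra.
  by have := del2; rewrite -[2 ^+ 2]/(2 * 2); lra.
have [G [G0 dG cG]] := gauss_fourier x v0.
have -> : gauss_density mu v m%:~R = gauss_density 0 v x.
  by rewrite /gauss_density subr0.
(* The primitive - (4 t^2 + 8 / v) exp (- v t^2 / 2) of the bound on the integrand contributes 8 / v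
   at 0. *)
have h1 : `|inv_prim del - G del| <= 8 / v.
  have := @derive_norm_le_seg R (fun t => inv_prim t - G t)
    (fun t => cos (x * t) * chf_re N p t + sin (x * t) * chf_im N p t
      - expR (- (v * t ^+ 2 / 2)) * cos (x * t))
    (fun t => - ((4 * t ^+ 2 + 8 / v) * expR (- (v * t ^+ 2 / 2))))
    (fun t => 4 * v * t ^+ 3 * expR (- (v * t ^+ 2 / 2))) 0 del (ltW del0).
  rewrite inv_prim0 G0 !subr0 => h.
  apply: (@le_trans _ _ (- ((4 * del ^+ 2 + 8 / v) * expR (- (v * del ^+ 2 / 2))) -
     - ((4 * 0 ^+ 2 + 8 / v) * expR (- (v * 0 ^+ 2 / 2))))); last first.
    rewrite !expr0n/= !mulr0 mul0r oppr0 expR0 mulr1 add0r opprK gerDr oppr_le0.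
    apply: mulr_ge0; last exact: expR_ge0.
    apply: addr_ge0; last by rewrite divr_ge0 ?(ltW v0).
    by apply: mulr_ge0 => //; exact: sqr_ge0.
  apply: h => t /andP[t0 td].
  - have hF := is_derive_inv_prim t; have hG := dG t t0.
    by der.
  - by der; field; exact: lt0r_neq0.
  - have td' : 0 <= t <= del by rewrite !ltW.
    have cs : cos (x * t) ^+ 2 + sin (x * t) ^+ 2 = 1 by exact: cos2Dsin2.
    (* The opposite unit vector provides the other half of the absolute value. *)
    have cs' : (- cos (x * t)) ^+ 2 + (- sin (x * t)) ^+ 2 = 1 by rewrite !sqrrN.
    have b1 := chf_gauss_le cs td'; have b2 := chf_gauss_le cs' td'.
    by rewrite ler_norml; apply/andP; split; lra.
have h2 : `|inv_prim pi - inv_prim del| <=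
    expR (- (2 * w / pi ^+ 2 * del ^+ 2)) / (2 * (2 * w / pi ^+ 2) * del).
  apply: (@gauss_tail_le R inv_prim
    (fun t => cos (x * t) * chf_re N p t + sin (x * t) * chf_im N p t)) => //.
  - by apply: divr_gt0; [exact: mulr_gt0|exact: exprn_gt0].
  - by move=> t _; exact: is_derive_inv_prim.
  - move=> t /andP[dt tp].
    have t0 : 0 <= t <= pi by rewrite (ltW tp) (le_trans (ltW del0) (ltW dt)).
    have cs : cos (x * t) ^+ 2 + sin (x * t) ^+ 2 = 1 by exact: cos2Dsin2.
    have cs' : (- cos (x * t)) ^+ 2 + (- sin (x * t)) ^+ 2 = 1 by rewrite !sqrrN.
    have b1 := chf_proj_le cs t0; have b2 := chf_proj_le cs' t0.
    by rewrite ler_norml; apply/andP; split; lra.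
(* With exp (- z) <= 1 / z at z = v del^2 / 2, the tail is at most 2 / (v^2 del^3), and v del^3 >= 7
   / 10. *)
have h3 T : del <= T -> `|G T - G del| <= 3 / v.
  move=> dT; apply: (@le_trans _ _ (expR (- (v / 2 * del ^+ 2)) / (2 * (v / 2) * del))).
    apply: (@gauss_tail_le R G (fun t => expR (- (v * t ^+ 2 / 2)) * cos (x * t))) => //.
    - by rewrite divr_gt0.
    - by move=> t /andP[dt _]; apply: dG; exact: le_trans (ltW del0) dt.
    - move=> t _; rewrite normrM ger0_norm ?expR_ge0//.
      have -> : v * t ^+ 2 / 2 = v / 2 * t ^+ 2 by ring.
      by rewrite ler_piMr ?expR_ge0// cos_max.
  have z0 : 0 < v / 2 * del ^+ 2 by apply: mulr_gt0; [exact: divr_gt0|exact: exprn_gt0].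
  have e : expR (- (v / 2 * del ^+ 2)) <= (v / 2 * del ^+ 2)^-1.
    rewrite expRN lef_pV2 ?posrE ?expR_gt0//.
    by apply: le_trans (expR_ge1Dx _); rewrite lerDr.
  rewrite ler_pdivrMr ?mulr_gt0 ?divr_gt0//; apply: (le_trans e).
  have -> : 3 / v * (2 * (v / 2) * del) = 3 * del by field; exact: lt0r_neq0.
  rewrite -div1r ler_pdivrMr//.
  have -> : 3 * del * (v / 2 * del ^+ 2) = 3 / 2 * (v * del ^+ 3) by field.
  by have := vdel_ge; lra.
(* The previous bound is uniform in T and passes to the limit. *)
have h4 : `|pi * gauss_density 0 v x - G del| <= 3 / v.
  have c : `|G T - G del| @[T --> +oo] --> `|pi * gauss_density 0 v x - G del|.
    by apply: cvg_norm; apply: cvgB => //; exact: cvg_cst.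
  rewrite -(cvg_lim _ c)//; apply: limr_le; first by apply/cvg_ex; eexists; exact: c.
  by near=> T; apply: h3; near: T; apply: nbhs_pinfty_ge; exact: num_real.
have h5 : pi * `|coef_int - gauss_density 0 v x| <=
    expR (- (2 * w / pi ^+ 2 * del ^+ 2)) / (2 * (2 * w / pi ^+ 2) * del) + 11 / v.
  rewrite -[X in X * _](gtr0_norm pi0) -normrM mulrBr [pi * coef_int]mulrC -inv_prim_pi.
  have -> : inv_prim pi - pi * gauss_density 0 v x = (inv_prim pi - inv_prim del) +
     (inv_prim del - G del) - (pi * gauss_density 0 v x - G del) by ring.
  apply: (le_trans (ler_normB _ _)).
  have := ler_normD (inv_prim pi - inv_prim del) (inv_prim del - G del).
  by move: h1 h2 h4; lra.
rewrite -(ler_pM2l pi0); apply: (le_trans h5).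
move: (pi : R) pi0 => q q0 {h5 h4 h3 h2 h1}.
rewrite le_eqVlt; apply/orP; left; apply/eqP.
by field; rewrite !lt0r_neq0.
Unshelve. all: by end_near. Qed.

End local_limit.

(** * Finitely supported random variables *)

Section finitely_supported.
Context {R : realType} {d : measure_display} {T : measurableType d}.
Variables (Pr : probability T R) (X : {RV Pr >-> R}) (n : nat) (q : nat -> R).
Hypothesis hX : forall m : nat, Pr (X @^-1` [set m%:R]) = (q m)%:E.
Hypothesis hq : \sum_(k < n) q k = 1.

Let F (k : nat) : set T := X @^-1` [set k%:R].

Let measurable_fiber (r : R) : measurable (X @^-1` [set r]).
Proof. by rewrite -[X in measurable X]setTI; exact: measurable_funP. Qed.

Let trivIset_fibers (D : set nat) : trivIset D F.
Proof.
move=> i j _ _ [t [/= hi hj]]; apply/eqP.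
by rewrite -(eqr_nat R) -hi hj.
Qed.

(** The n fibres are disjoint and their probabilities already sum to 1. *)
Let support_compl0 : Pr (~` \big[setU/set0]_(k < n) F k) = 0%E.
Proof.
have mF : measurable (\big[setU/set0]_(k < n) F k).
  by apply: bigsetU_measurable => k _; exact: measurable_fiber.
rewrite probability_setC// measure_semi_additive_ord_I//; last first.
  by move=> k _; exact: measurable_fiber.
have -> : (\sum_(i < n) Pr (F i) = 1%:E)%E.
  by rewrite -hq -sumEFin; apply: eq_bigr => k _; exact: hX.
by rewrite subee.
Qed.

Lemma probability_off_support (r : R) : (forall k : 'I_n, r != k%:R) ->
  Pr (X @^-1` [set r]) = 0%E.
Proof.
move=> hr; apply/eqP; rewrite -measure_le0 -support_compl0.
apply: le_measure; rewrite ?inE//.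
- by apply: measurableC; apply: bigsetU_measurable => k _; exact: measurable_fiber.
- move=> t /= Xr; rewrite -bigcup_mkord => -[k /= kn Xk].
  by have := hr (Ordinal kn); rewrite -Xk Xr eqxx.
Qed.

(** Almost everywhere h o X equals a combination of the indicators of the fibres, which is
    integrated termwise. *)
Lemma integral_finitely_supported (h : R -> R) : measurable_fun setT h ->
  (\int[Pr]_t (h (X t))%:E = (\sum_(k < n) h k%:R * q k)%:E)%E.
Proof.
move=> mh.
pose g (t : T) : \bar R := (\sum_(k < n) (h k%:R)%:E * (\1_(F k) t)%:E)%E.
have ig (k : 'I_n) : Pr.-integrable setT (fun t => ((h k%:R)%:E * (\1_(F k) t)%:E)%E).
  by apply: integrableZl => //; apply: integrable_indic; exact: measurable_fiber.
rewrite (@ae_eq_integral _ _ _ Pr setT g); last 4 first.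
- exact: measurableT.
- by apply/measurable_EFinP; apply: measurableT_comp.
- by apply: (@measurable_int _ _ _ Pr); apply: integrable_sum => // k _; exact: ig.
- exists (~` \big[setU/set0]_(k < n) F k); split.
  + by apply: measurableC; apply: bigsetU_measurable => k _; exact: measurable_fiber.
  + exact: support_compl0.
  + move=> t /= hne; rewrite -bigcup_mkord => -[k /= kn Fk]; apply: hne => _.
    rewrite /g (bigD1 (Ordinal kn))//= big1 ?adde0.
      by rewrite indicE mem_set// mule1 Fk.
    move=> j jk; rewrite indicE memNset ?mule0//= => Fj.
    move/eqP: jk; apply; apply: val_inj => /=.
    by apply: (@trivIset_fibers setT j k I I); exists t.
rewrite integral_sum//.
rewrite -sumEFin; apply: eq_bigr => k _.
rewrite integralZl//; last by apply: integrable_indic; exact: measurable_fiber.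
rewrite integral_indic//; last exact: measurable_fiber.
by rewrite setIT EFinM; congr (_ * _)%E; exact: hX.
Qed.

Lemma expectation_finitely_supported : ('E_Pr[X] = (\sum_(k < n) k%:R * q k)%:E)%E.
Proof. by rewrite unlock (@integral_finitely_supported id). Qed.

Lemma variance_finitely_supported (mu := \sum_(k < n) k%:R * q k) :
  ('V_Pr[X] = (\sum_(k < n) (k%:R - mu) ^+ 2 * q k)%:E)%E.
Proof.
rewrite /variance unlock expectation_finitely_supported/= -/mu unlock.
rewrite -(@integral_finitely_supported (fun y => (y - mu) ^+ 2)).
  by apply: eq_integral => t _; rewrite /= expr2.
by apply: measurable_funX; apply: measurable_funB.
Qed.

End finitely_supported.

(** * Choice of the cutoff *)

Section local_limit_bound.
Context {R : realType}.

Lemma powR_third_cube (x : R) : 0 <= x -> (x `^ (1 / 3)) ^+ 3 = x.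
Proof.
move=> x0; rewrite -powR_mulrn ?powR_ge0// -powRrM.
by rewrite mul1r mulVf// powRr1.
Qed.

Lemma powR_two_thirds (x : R) : 0 <= x -> x `^ (2 / 3) = (x `^ (1 / 3)) ^+ 2.
Proof.
move=> x0; rewrite -powR_mulrn ?powR_ge0// -powRrM; congr (_ `^ _).
by rewrite mul1r mulrC.
Qed.

Variables (N : nat) (p : {poly R}) (eta : 'I_N -> R[i]).
Hypothesis hdeg : size p = N.+1.
Hypothesis hp : forall m : nat, 0 <= p`_m.
Hypothesis hpN : 0 < p`_N.
Hypothesis hfact : map_poly (real_complex R) p =
  (real_complex R p`_N) *: \prod_(j < N) ('X + (eta j)%:P).
Hypothesis heta : forall j : 'I_N, 0 <= complex.Re (eta j).

Let v := var N p.
Let w := weight eta.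

Lemma llt_coef (m : int) : 0 < w -> 1 <= v ->
  `|coef_int p m - gauss_density (mean N p) v m%:~R| <=
  pi / 4 `^ (2 / 3) * (v `^ (1 / 3) / w) *
    expR (- (4 `^ (1 / 3) / pi ^+ 2 * (w / v `^ (2 / 3)))) + 24 / (pi * v).
Proof.
move=> w0 v1; have v0 : 0 < v by lra.
have pi0 := pi_gt0 R.
set f := 4 `^ (1 / 3); set s := v `^ (1 / 3).
have f0 : 0 < f by exact: powR_gt0.
have s0 : 0 < s by exact: powR_gt0.
have f3 : f ^+ 3 = 4 by exact: powR_third_cube.
have s3 : s ^+ 3 = v by apply: powR_third_cube; exact: ltW.
rewrite !powR_two_thirds ?(ltW v0)// -/f -/s.
(* With the cutoff [r / s], whose square is [f / (2 s^2)], the tail bound of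
   [llt_real] has exactly the exponent of the statement. *)
pose r := Num.sqrt (f / 2); have r0 : 0 < r by rewrite sqrtr_gt0 divr_gt0.
have r2 : r ^+ 2 = f / 2 by rewrite sqr_sqrtr// divr_ge0 ?(ltW f0).
have del0 : 0 < r / s by rewrite divr_gt0.
(* (8 / 5)^3 = 4.096 exceeds f^3 = 4; this makes r^2 = f / 2 at most 4 / 5. *)
have f_le : f <= 8 / 5.
  rewrite leNgt; apply/negP => h; have : (8 / 5 : R) ^+ 3 < f ^+ 3.
    by rewrite ltr_pXn2r// ?nnegrE; lra.
  by rewrite f3; lra.
have s1 : 1 <= s.
  rewrite leNgt; apply/negP => h; have : s ^+ 3 < 1 ^+ 3.
    by rewrite ltr_pXn2r// ?nnegrE; lra.
  by rewrite s3 expr1n; lra.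
have del2 : (r / s) ^+ 2 <= 4 / 5.
  rewrite expr_div_n r2 ler_pdivrMr ?exprn_gt0//.
  have : 1 <= s ^+ 2 by rewrite exprn_ege1.
  by lra.
have vd : v * (r / s) ^+ 3 = r ^+ 3.
  by rewrite -s3 expr_div_n mulrC divfK// expf_neq0// lt0r_neq0.
(* Places r^3 by squaring: 0.49 <= 1 / 2 <= 0.5041. *)
have r6 : (r ^+ 3) ^+ 2 = 1 / 2.
  rewrite -exprM mulnC exprM r2 expr_div_n f3.
  by field.
have r3 : 0 < r ^+ 3 by rewrite exprn_gt0.
have vd1 : 7 / 10 <= v * (r / s) ^+ 3.
  rewrite vd leNgt; apply/negP => h; have : (r ^+ 3) ^+ 2 < (7 / 10) ^+ 2.
    by rewrite ltr_pXn2r// ?nnegrE; lra.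
  by rewrite r6; lra.
have vd2 : v * (r / s) ^+ 3 <= 71 / 100.
  rewrite vd leNgt; apply/negP => h; have : (71 / 100) ^+ 2 < (r ^+ 3) ^+ 2.
    by rewrite ltr_pXn2r// ?nnegrE; lra.
  by rewrite r6; lra.
apply: (le_trans (llt_real hdeg hp hpN hfact heta m del0 del2 vd1 vd2 w0 v0)).
rewrite -/w -/v; apply: lerD; last first.
  by rewrite ler_wpM2r ?invr_ge0 ?mulr_ge0 ?(ltW pi0) ?(ltW v0)//; lra.
have -> : 2 * w / pi ^+ 2 * (r / s) ^+ 2 = f / pi ^+ 2 * (w / s ^+ 2).
  rewrite expr_div_n r2; move: (pi : R) pi0 => c c0.
  by field; rewrite !lt0r_neq0.
apply: ler_wpM2r; first exact: expR_ge0.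
have -> : pi / (4 * w * (r / s)) = pi * (s / w) * (4 * r)^-1.
  move: (pi : R) pi0 => c c0; by field; rewrite !lt0r_neq0.
have -> : pi / f ^+ 2 * (s / w) = pi * (s / w) * (f ^+ 2)^-1 by ring.
apply: ler_wpM2l; first by rewrite mulr_ge0 ?divr_ge0 ?ltW.
rewrite lef_pV2 ?posrE ?exprn_gt0 ?mulr_gt0//.
(* f^2 <= 4 r by comparing squares: f^4 = 4 f and 16 r^2 = 8 f. *)
rewrite -(@ler_pXn2r _ 2)// ?nnegrE ?mulr_ge0 ?exprn_ge0 ?(ltW r0) ?(ltW f0)//.
have -> : (f ^+ 2) ^+ 2 = f ^+ 3 * f by ring.
by rewrite f3 exprMn r2; lra.
Qed.

End local_limit_bound.

(** * Transfer to the random variable *)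

Theorem theorem3p7 (R : realType) (N : nat) (p : {poly R})
    (eta : 'I_N -> R[i])
    (d : measure_display) (T : measurableType d) (Pr : probability T R)
    (X : {RV Pr >-> R})
    (hN : (1 <= N)%N)
    (hdeg : size p = N.+1)
    (hp : forall m : nat, 0 <= p`_m)
    (hpN : 0 < p`_N)
    (hp0 : 0 < p`_0)
    (hfact : map_poly (real_complex R) p =
             (real_complex R p`_N) *: \prod_(j < N) ('X + (eta j)%:P))
    (heta : forall j : 'I_N, 0 <= complex.Re (eta j))
    (hX : forall m : nat, Pr (X @^-1` [set m%:R]) = (p`_m / p.[1])%:E)
    (hV : (1 <= 'V_Pr[X])%E) :
  (ereal_sup (range (fun m : int =>
     `| Pr (X @^-1` [set m%:~R])
        - (gauss_density (fine 'E_Pr[X]) (fine 'V_Pr[X]) m%:~R)%:E |))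
   <= llt_bound (fine 'V_Pr[X]) (weight eta))%E.
Proof.
have hq := sum_prob hdeg hp hpN.
have hE : 'E_Pr[X]%E = (mean N p)%:E := expectation_finitely_supported hX hq.
have hVar : 'V_Pr[X]%E = (var N p)%:E := variance_finitely_supported hX hq.
rewrite hE hVar/=; rewrite hVar lee_fin in hV.
have w_ge0 : 0 <= 4 * weight eta.
  rewrite weight_roots; apply: sumr_ge0 => j _; apply: divr_ge0; first exact: heta.
  by rewrite addr_ge0// addr_ge0 ?sqr_ge0.
have pi0 := pi_gt0 R.
(* For zero weight the first term of the bound is +oo, all its other factors being positive. *)
have [w0|w_neq0] := eqVneq (weight eta) 0.
  rewrite /llt_bound w0 inve0 gt0_muley ?lte_fin ?powR_gt0 ?(lt_le_trans ltr01 hV)//.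
  rewrite gt0_muley ?lte_fin ?divr_gt0 ?powR_gt0//.
  by rewrite gt0_mulye ?lte_fin ?expR_gt0// addye ?leey.
have w0 : 0 < weight eta by rewrite lt_def w_neq0/=; lra.
apply: ge_ereal_sup => _ [m _ <-].
have -> : Pr (X @^-1` [set m%:~R]) = (coef_int p m)%:E.
  (* A negative integer lies off the support, where [coef_int] is 0. *)
  case: m => k; first exact: hX.
  apply: (probability_off_support hX hq) => j.
  rewrite NegzE -[j%:R]/((Posz j)%:~R) eqr_int.
  by case: (nat_of_ord j).
rewrite /llt_bound inver (negbTE w_neq0) -EFinB abse_EFin -!EFinM -EFinD lee_fin.
exact: llt_coef.
Qed.
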